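(* For any maximal toral subalgebra $\mathfrak{t}\subseteq\mathfrak{sl}(V,V_* )$, we have $$\mathfrak{z}_{\mathfrak{sl}(V,V_* )}(\mathfrak{t})=\mathfrak{t}\oplus(V^0\otimes V_*^0),$$ which is an abelian Lie algebra.
   Context: Everything is over $\mathbb{C}$. $V,V_*$ are countably infinite-dimensional vector spaces with a nondegenerate pairing $\langle\cdot,\cdot\rangle:V\times V_*\to\mathbb{C}$. $V\otimes V_*$ is an associative algebra with $(v\otimes w)\cdot(v'\otimes w')=\langle v',w\rangle\,v\otimes w'$; $\mathfrak{gl}(V,V_* )$ is its Lie algebra and $\mathfrak{sl}(V,V_* )$ is the derived subalgebra of $\mathfrak{gl}(V,V_* )$. The natural actions are $(v\otimes w)\cdot u=\langle u,w\rangle v$ on $V$ and $(v\otimes w)\cdot u=-\langle v,u\rangle w$ on $V_*$. $\mathfrak{sl}(V,V_* )$ is a union of nested finite-dimensional reductive subalgebras, each reductive in the next; an element is semisimple if it is semisimple in these (equivalently in all large enough ones), and a subalgebra is toral if all its elements are semisimple. For $M=V$ or $V_*$, $M^0:=\{m\in M:\exists\, i\in\mathbb{Z}_{>0}\text{ such that }x^i\cdot m=0\ \forall x\in\mathfrak{t}\}$ is the generalized zero weight space of $\mathfrak{t}$ in $M$. $\mathfrak{z}_{\mathfrak{sl}(V,V_* )}(\mathfrak{t})$ is the centralizer of $\mathfrak{t}$. *)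

(* Defs.v *)
From HB Require Import structures.
From mathcomp Require Import all_boot all_order all_algebra.
From mathcomp Require Export complex.
From mathcomp Require Import boolp classical_sets.
From mathcomp Require Export reals.

Set Implicit Arguments.
Unset Strict Implicit.
Unset Printing Implicit Defensive.

Import GRing.Theory.
Local Open Scope ring_scope.
Local Open Scope classical_set_scope.

Section LinearAlgebra.
Context {K : closedFieldType}.

(* A sequence that is a Hamel basis. *)
Definition is_countable_basis (M : lmodType K) (e : nat -> M) : Prop :=
  (forall n (c : 'I_n -> K),
     \sum_(i < n) c i *: e i = 0 -> forall i, c i = 0) /\
  (forall m : M, exists n (c : 'I_n -> K), m = \sum_(i < n) c i *: e i).

Definition countably_infinite_dim (M : lmodType K) : Prop :=
  exists e : nat -> M, is_countable_basis e.

Definition nondegenerate_pairing (V Vs : lmodType K)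
    (pair : {bilinear V -> Vs -> K | *%R & *%R}) : Prop :=
  (forall v, (forall w, pair v w = 0) -> v = 0) /\
  (forall w, (forall v, pair v w = 0) -> w = 0).

Definition is_subspace (M : lmodType K) (S : set M) : Prop :=
  S 0 /\ (forall (a : K) (x y : M), S x -> S y -> S (a *: x + y)).

Definition span (M : lmodType K) (A : set M) : set M :=
  smallest (@is_subspace M) A.

Definition finite_dim (M : lmodType K) (S : set M) : Prop :=
  exists s : seq M, S = span [set x | x \in s].

Definition is_direct_sum (M : lmodType K) (A B S : set M) : Prop :=
  S = [set x + y | x in A & y in B] /\ A `&` B = [set 0].

Definition is_tensor_product (V W T : lmodType K)
    (tens : {bilinear V -> W -> T}) : Prop :=
  forall (U : lmodType K) (f : {bilinear V -> W -> U}),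
    (exists g : {linear T -> U}, forall v w, g (tens v w) = f v w) /\
    (forall g1 g2 : {linear T -> U},
       (forall v w, g1 (tens v w) = f v w) ->
       (forall v w, g2 (tens v w) = f v w) -> g1 =1 g2).

End LinearAlgebra.

(* A tensor product of V and Vs (in the sense of the universal property) with
   its associative product and its natural actions on V and Vs.  As pure tensors
   span, the three operations are uniquely determined by their formulas. *)
Record tensor_algebra {K : closedFieldType} (V Vs : lmodType K)
    (pair : {bilinear V -> Vs -> K | *%R & *%R}) := TensorAlgebra {
  tsort :> lmodType K;
  tens : {bilinear V -> Vs -> tsort};
  tensP : is_tensor_product tens;
  tmul : {bilinear tsort -> tsort -> tsort};
  tmulE : forall v w v' w',
    tmul (tens v w) (tens v' w') = pair v' w *: tens v w';
  actV : {bilinear tsort -> V -> V};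
  actVE : forall v w u, actV (tens v w) u = pair u w *: v;
  actVs : {bilinear tsort -> Vs -> Vs};
  actVsE : forall v w u, actVs (tens v w) u = - (pair v u *: w)
}.

Section Mackey.
Context {K : closedFieldType} {V Vs : lmodType K}.
Context {pair : {bilinear V -> Vs -> K | *%R & *%R}}.
Context {gl : tensor_algebra pair}.

Definition bracket (x y : gl) : gl := tmul gl x y - tmul gl y x.

Definition is_subalgebra (h : set gl) : Prop :=
  is_subspace h /\ (forall x y, h x -> h y -> h (bracket x y)).

Definition is_abelian (h : set gl) : Prop :=
  forall x y, h x -> h y -> bracket x y = 0.

Definition sl : set gl :=
  span [set z | exists x y : gl, z = bracket x y].

Definition ad_stable (h M : set gl) : Prop :=
  forall x m, h x -> M m -> M (bracket x m).

(* g is a semisimple h-module under the adjoint action of h. *)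
Definition reductive_in (h g : set gl) : Prop :=
  forall M : set gl, is_subspace M -> M `<=` g -> ad_stable h M ->
  exists N : set gl,
    [/\ is_subspace N, N `<=` g, ad_stable h N & is_direct_sum M N g].

(* The adjoint representation of g is semisimple. *)
Definition reductive (g : set gl) : Prop := reductive_in g g.

Definition reductive_exhaustion (g : nat -> set gl) : Prop :=
  [/\ forall n, [/\ is_subalgebra (g n), finite_dim (g n) & reductive (g n)],
      forall n, g n `<=` g n.+1,
      forall n, reductive_in (g n) (g n.+1) &
      \bigcup_n g n = sl].

(* ad x is diagonalizable on g; over an algebraically closed field this is
   semisimplicity of the endomorphism ad x of g. *)
Definition ad_semisimple (g : set gl) (x : gl) : Prop :=
  g `<=` span [set y | g y /\ exists a : K, bracket x y = a *: y].

(* Semisimplicity in the members of an exhaustion does not depend on the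
   exhaustion, nor on the member, so "some exhaustion" and "all large enough
   members" are harmless choices. *)
Definition semisimple (x : gl) : Prop :=
  exists g : nat -> set gl, reductive_exhaustion g /\
  exists N, forall n, (N <= n)%N -> g n x /\ ad_semisimple (g n) x.

Definition toral_subalgebra (t : set gl) : Prop :=
  [/\ is_subalgebra t, t `<=` sl & forall x, t x -> semisimple x].

Definition maximal_toral (t : set gl) : Prop :=
  toral_subalgebra t /\
  (forall s, toral_subalgebra s -> t `<=` s -> s = t).

Definition centralizer_sl (t : set gl) : set gl :=
  [set x | sl x /\ forall y, t y -> bracket x y = 0].

Definition V0 (t : set gl) : set V :=
  [set v | exists i, (0 < i)%N /\
     forall x, t x -> iter i (actV gl x) v = 0].

Definition Vs0 (t : set gl) : set Vs :=
  [set w | exists i, (0 < i)%N /\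
     forall x, t x -> iter i (actVs gl x) w = 0].

(* The tensor product of two subspaces, as a subspace of V (x) Vs. *)
Definition tensor_set (A : set V) (B : set Vs) : set gl :=
  span [set z | exists v w, [/\ A v, B w & z = tens gl v w]].

End Mackey.

(* Main.v *)
Require Import Defs.
From HB Require Import structures.
From mathcomp Require Import all_boot all_order all_algebra.
From mathcomp Require Import boolp classical_sets reals complex.

(* In a pair of dual bases of V and V_* the algebra V (x) V_* becomes the algebra
   of finite matrices, and x in sl is semisimple iff it is diagonalizable on V:
   one direction tests ad x on v (x) w with x w = 0, the other uses the
   exhaustion by traceless n x n matrices.  So t is abelian, and every
   diagonalizable y in sl commuting with t lies in t.

   Simultaneous eigenprojections q of t exist by a minimal rank argument.  By
   maximality they have rank one, as otherwise u (x) w - u' (x) w' with u, u' in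
   the image of q would lie in t without acting on it by a scalar.  Likewise V^0
   and V_*^0 are orthogonal, since for <v, w> = 1 the element v (x) w - u (x) w'
   with u, w' of a nonzero weight would lie in t without killing v in V^0.

   If z commutes with t, then z q = k q for each such q, so removing finitely many
   k q from z leaves z'' with z'' t = t z'' = 0.  Then z'' = z'' r z'' for some r
   shows that z'' lies in V^0 (x) V_*^0, and z - z'' is a diagonalizable element of
   sl commuting with t, hence in t. *)

Set Implicit Arguments.
Unset Strict Implicit.
Unset Printing Implicit Defensive.

Import GRing.Theory Num.Theory.
Local Open Scope ring_scope.
Local Open Scope classical_set_scope.

Local Notation span := Defs.span.

(** * Products of shifts of a linear operator *)

Section Subspaces.
Context {K : closedFieldType} {M : lmodType K}.
Implicit Types (S A B : set M) (x y : M).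

Lemma subspace0 S : is_subspace S -> S 0.
Proof. by case. Qed.

Lemma subspaceD S x y : is_subspace S -> S x -> S y -> S (x + y).
Proof. by move=> [_ h] Sx Sy; rewrite -[x]scale1r; apply: h. Qed.

Lemma subspaceZ S a x : is_subspace S -> S x -> S (a *: x).
Proof. by move=> [S0 h] Sx; rewrite -[_ *: _]addr0; apply: h. Qed.

Lemma subspaceB S x y : is_subspace S -> S x -> S y -> S (x - y).
Proof.
by move=> hS Sx Sy; apply: subspaceD => //; rewrite -scaleN1r; apply: subspaceZ.
Qed.

Lemma subspace_sum S (I : Type) (r : seq I) (P : pred I) (F : I -> M) :
  is_subspace S -> (forall i, P i -> S (F i)) -> S (\sum_(i <- r | P i) F i).
Proof.
move=> hS hF; apply: (big_ind S) => //; first exact: subspace0.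
by move=> x y; apply: subspaceD.
Qed.

Lemma span_subspace A : is_subspace (span A).
Proof.
split; first by move=> S [[S0 _] _].
by move=> a x y hx hy S hS; apply: hS.1.2; [exact: hx | exact: hy].
Qed.

Lemma subset_span A : A `<=` span A.
Proof. by move=> x Ax S [_ hS]; apply: hS. Qed.

Lemma span_min A S : is_subspace S -> A `<=` S -> span A `<=` S.
Proof. by move=> hS AS x hx; apply: hx. Qed.

Lemma subspaceI A B : is_subspace A -> is_subspace B -> is_subspace (A `&` B).
Proof.
move=> [A0 hA] [B0 hB]; split=> // a x y [Ax Bx] [Ay By].
by split; [exact: hA | exact: hB].
Qed.

End Subspaces.


Lemma subspace_preimage (K : closedFieldType) (M N : lmodType K)
  (f : {linear M -> N}) (S : set N) : is_subspace S -> is_subspace (f @^-1` S).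
Proof.
move=> [S0 hS]; split=> [|a x y Sx Sy] /=; first by rewrite linear0.
by rewrite linearP; apply: hS.
Qed.

Section ShiftProducts.
Context {K : closedFieldType} {M : lmodType K}.
Implicit Types (f g : {linear M -> M}) (s : seq K) (m : M).

Definition shift (f : M -> M) (a : K) (m : M) : M := f m - a *: m.

(* [shifts f m s = 0] with [uniq s] says that [m] is a sum of eigenvectors of [f]
   with eigenvalues in [s]; no finite dimensionality is involved. *)
Definition shifts (f : M -> M) (m : M) (s : seq K) : M := foldr (shift f) m s.

Lemma shiftP f a : linear (shift f a).
Proof.
move=> b x y; rewrite /shift linearP scalerDr !scalerA mulrC opprD addrACA.
by rewrite scalerBr scalerA.
Qed.

Lemma shifts_linear f s : linear (shifts f ^~ s).
Proof.
by elim: s => //= a s IH b x y; rewrite IH shiftP.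
Qed.

Lemma shifts0 f s : shifts f 0 s = 0.
Proof. by elim: s => //= a s ->; rewrite /shift linear0 scaler0 subr0. Qed.

Lemma shiftC f a b m : shift f a (shift f b m) = shift f b (shift f a m).
Proof.
rewrite /shift !linearB /= [f (b *: m)]linearZ [f (a *: m)]linearZ /=.
by rewrite !scalerA [b * a]mulrC !opprK addrACA.
Qed.

Lemma shifts_shift f a m s : shifts f (shift f a m) s = shift f a (shifts f m s).
Proof. by elim: s => //= b s ->; rewrite shiftC. Qed.

Lemma shifts_cat f m s1 s2 : shifts f m (s1 ++ s2) = shifts f (shifts f m s2) s1.
Proof. by rewrite /shifts foldr_cat. Qed.

Lemma perm_shifts f m s1 s2 : perm_eq s1 s2 -> shifts f m s1 = shifts f m s2.
Proof.
move=> h; rewrite /shifts.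
elim: s1 s2 h => [|a s1 IH] s2; first by move/perm_size/esym/size0nil->.
move=> h; have as2 : a \in s2 by rewrite -(perm_mem h) mem_head.
have [p1 [p2 E]] : exists p1 p2, s2 = p1 ++ a :: p2.
  by case/splitPr: as2 => p1 p2; exists p1, p2.
subst s2; move: h; rewrite perm_sym perm_catC /= perm_cons => h.
rewrite /= (IH (p1 ++ p2)); last by rewrite perm_sym perm_catC.
by rewrite -!/(shifts _ _ _) !shifts_cat /= shifts_shift.
Qed.

(** Shifts commute, so the factors from [s1] can be applied first; [uniq s1] ensures that [s2]
    contains each of them often enough. *)
Lemma shifts_sub f m s1 s2 :
  uniq s1 -> {subset s1 <= s2} -> shifts f m s1 = 0 -> shifts f m s2 = 0.
Proof.
elim: s1 s2 m => [|a s1 IH] s2 m /=; first by move=> _ _ ->; rewrite shifts0.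
move=> /andP[as1 us1] sub12.
rewrite -/(shifts f m s1) -shifts_shift => h.
have as2 : a \in s2 by apply: sub12; rewrite mem_head.
rewrite (perm_shifts f m (perm_to_rem as2)) /= -/(shifts _ _ _) -shifts_shift.
apply: IH h => // b bs1; have := sub12 b.
rewrite inE bs1 orbT => /(_ isT).
rewrite (perm_mem (perm_to_rem as2)) inE => /orP[/eqP ba|//].
by rewrite -ba bs1 in as1.
Qed.

Lemma shifts_eigen f a m s :
  f m = a *: m -> shifts f m s = (\prod_(b <- s) (a - b)) *: m.
Proof.
move=> fm; elim: s => [|b s IH] /=; first by rewrite big_nil scale1r.
rewrite -/(shifts _ _ _) IH /shift linearZ /= fm big_cons !scalerA -scalerBl.
by rewrite mulrBl [_ * a]mulrC.
Qed.

Lemma prod_shift_neq0 (a : K) s : a \notin s -> \prod_(b <- s) (a - b) != 0.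
Proof.
move=> as_; rewrite prodf_seq_neq0; apply/allP => b bs /=; rewrite subr_eq0.
by apply: contraNN as_ => /eqP ->.
Qed.

(** The vector [shift f a m] is an eigenvector for [a] and is also killed by the shifts by the other
    roots, which act on it by a nonzero scalar. *)
Lemma shift_sqr0 f a m s : uniq s -> shifts f m s = 0 ->
  shift f a (shift f a m) = 0 -> shift f a m = 0.
Proof.
move=> us h hm; have fm : f (shift f a m) = a *: shift f a m.
  by apply/eqP; rewrite -subr_eq0; apply/eqP.
have : shifts f (shift f a m) (rem a s) = 0.
  have [as_|as_] := boolP (a \in s).
    by move: h; rewrite (perm_shifts f m (perm_to_rem as_)) /= shifts_shift.
  by rewrite rem_id // shifts_shift h /shift linear0 scaler0 subr0.
rewrite (shifts_eigen _ fm) => /eqP; rewrite scaler_eq0 => /orP[|/eqP//].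
by rewrite (negPf (prod_shift_neq0 _)) // mem_rem_uniqF.
Qed.

Lemma sqr0_of_shifts f m s : uniq s -> shifts f m s = 0 ->
  f (f m) = 0 -> f m = 0.
Proof.
move=> us h hm; have := @shift_sqr0 f 0 m s us h.
by rewrite /shift !scale0r !subr0; apply.
Qed.

Lemma span_eigen f s (S : set M) m :
  is_subspace S -> (forall x, S x -> S (f x)) -> uniq s -> S m ->
  shifts f m s = 0 ->
  span [set x | S x /\ exists2 a, a \in s & f x = a *: x] m.
Proof.
move=> hS fS; have shiftS a x : S x -> S (shift f a x).
  by move=> Sx; apply: subspaceB => //; [exact: fS | exact: subspaceZ].
have shiftsS s' x : S x -> S (shifts f x s') by move=> Sx; elim: s' => //= *; apply: shiftS.
elim: s m => [|a s IH] m /=; first by move=> _ _ ->; exact: (subspace0 (span_subspace _)).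
move=> /andP[as_ us] Sm h; set m' := shifts f m s in h *.
have fm' : f m' = a *: m' by apply/eqP; rewrite -subr_eq0; apply/eqP.
pose k := \prod_(b <- s) (a - b); have k0 : k != 0 by apply: prod_shift_neq0.
have Sm' : S m' by apply: shiftsS.
(* The shifts by [s] multiply the eigenvector [m'] by [k] and send [m] to [m'], so they kill
   [m - k^-1 *: m'], to which the induction applies. *)
rewrite -[m](subrK (k^-1 *: m')); apply: (subspaceD (span_subspace _)).
- apply: (span_min (@span_subspace _ _ _) _ (IH _ us _ _)).
  + move=> x [Sx [b bs fx]]; apply: subset_span; split=> //.
    by exists b; rewrite ?inE ?bs ?orbT.
  + by apply: subspaceB => //; apply: subspaceZ.
  + rewrite addrC -scaleNr shifts_linear.
    by rewrite (shifts_eigen _ fm') -/k scalerA mulNr mulVf // scaleN1r addNr.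
- apply: subset_span; split; first exact: subspaceZ.
  by exists a; rewrite ?mem_head // linearZ /= fm' !scalerA mulrC.
Qed.

Lemma shifts_span f s (A : set M) m : uniq s ->
  A `<=` [set x | exists2 a, a \in s & f x = a *: x] -> span A m ->
  shifts f m s = 0.
Proof.
move=> us hA; apply: (span_min (S := [set x | shifts f x s = 0])).
  split; first exact: shifts0.
  by move=> a x y /= hx hy; rewrite shifts_linear hx hy scaler0 addr0.
move=> x /hA[a as_ fx] /=; rewrite (shifts_eigen _ fx).
by rewrite (big_rem _ as_) /= subrr mul0r scale0r.
Qed.

Lemma span_eigen_shifts f m : span [set x | exists a, f x = a *: x] m ->
  exists2 s, uniq s & shifts f m s = 0.
Proof.
apply: (span_min (S := [set x | exists2 s, uniq s & shifts f x s = 0])).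
  split; first by exists [::].
  move=> a x y [s1 us1 h1] [s2 us2 h2]; exists (undup (s1 ++ s2)).
    exact: undup_uniq.
  rewrite shifts_linear (shifts_sub us1 _ h1) ?(shifts_sub us2 _ h2) ?scaler0 ?addr0 //.
    by move=> b bs; rewrite mem_undup mem_cat bs orbT.
  by move=> b bs; rewrite mem_undup mem_cat bs.
move=> x [a fx]; exists [:: a] => //=.
by rewrite /shift fx subrr.
Qed.

(** Each eigenspace of [f] is stable under [g], so every vector is a sum of joint eigenvectors, on
    which [h] acts by a sum [a + b] of roots. *)
Lemma shiftsD f g (h : {linear M -> M}) s1 s2 : (forall m, h m = f m + g m) ->
  (forall m, f (g m) = g (f m)) -> uniq s1 -> uniq s2 ->
  (forall m, shifts f m s1 = 0) -> (forall m, shifts g m s2 = 0) ->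
  forall m, shifts h m (undup [seq a + b | a <- s1, b <- s2]) = 0.
Proof.
move=> hE fgC us1 us2 h1 h2 m.
pose s := undup [seq a + b | a <- s1, b <- s2].
apply: (@shifts_span _ s [set x | exists2 c, c \in s & h x = c *: x]).
- exact: undup_uniq.
- by [].
have hT : is_subspace (@setT M) by [].
apply: span_min (span_eigen hT _ us1 I (h1 m)) => //; first exact: span_subspace.
move=> x [_ [a as1 fx]].
have hS : is_subspace [set y | f y = a *: y].
  split=> [|b y z /= hy hz]; first by rewrite /= linear0 scaler0.
  by rewrite linearP hy hz scalerDr !scalerA mulrC.
have gS y : f y = a *: y -> f (g y) = a *: g y.
  by move=> fy; rewrite fgC fy linearZ.
apply: span_min (span_eigen hS gS us2 fx (h2 x)); first exact: span_subspace.
move=> y [fy [b bs2 gy]].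
apply: subset_span; exists (a + b); first by rewrite mem_undup; apply: allpairs_f.
by rewrite hE fy gy scalerDl.
Qed.

End ShiftProducts.

(** * Dual bases *)

Section DualSystems.
Context {K : closedFieldType} {V Vs : lmodType K}.
Variable pair : {bilinear V -> Vs -> K | *%R & *%R}.
Implicit Types (g : nat -> V * Vs) (v : V) (w : Vs).

Definition dual_system g n := forall i j, (i < n)%N -> (j < n)%N ->
  pair (g i).1 (g j).2 = (i == j)%:R.

(** For a dual system this is the projection onto the span of the first [n] vectors along the common
    kernel of the first [n] covectors. *)
Definition dual_proj g n v := \sum_(i < n) pair v (g i).2 *: (g i).1.

Lemma pair_dual_proj g n v j : dual_system g n -> (j < n)%N ->
  pair (dual_proj g n v) (g j).2 = pair v (g j).2.
Proof.
move=> gn jn; rewrite linear_sumlz (bigD1 (Ordinal jn)) //= big1 ?addr0.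
  by rewrite linearZl_LR /= gn // eqxx mulr1.
by move=> i; rewrite -val_eqE /= => ij; rewrite linearZl_LR /= gn // (negPf ij) mulr0.
Qed.

Lemma pair_dual_proj0 g n v w : (forall i, (i < n)%N -> pair (g i).1 w = 0) ->
  pair (dual_proj g n v) w = 0.
Proof.
by move=> h; rewrite linear_sumlz big1 // => i _; rewrite linearZl_LR /= h ?mulr0.
Qed.

Lemma dual_system_covector g n v : (forall v, (forall w, pair v w = 0) -> v = 0) ->
  dual_system g n -> v != dual_proj g n v ->
  exists w, (forall i, (i < n)%N -> pair (g i).1 w = 0) /\
    pair (v - dual_proj g n v) w = 1.
Proof.
move=> nondeg gn; set r := _ - _; rewrite -subr_eq0 -/r => r0.
have [w1 rw1] : exists w, pair r w != 0.
  by apply: contrapT => h; case/eqP: r0; apply: nondeg => w;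
    apply: contrapT => rw; apply: h; exists w; apply/eqP.
(* Gram-Schmidt correction: [w2] vanishes on the vectors of the system, and its value on [r] is that
   of [w1] because the covectors of the system vanish on [r]. *)
pose w2 := w1 - \sum_(i < n) pair (g i).1 w1 *: (g i).2.
have rg j : (j < n)%N -> pair r (g j).2 = 0.
  by move=> jn; rewrite linearBl pair_dual_proj // subrr.
have rw2 : pair r w2 = pair r w1.
  rewrite linearBr linear_sumr big1 ?subr0 // => j _.
  by rewrite linearZr_LR /= rg ?mulr0.
exists ((pair r w1)^-1 *: w2); split; last by rewrite linearZr_LR /= rw2 mulVf.
move=> i ilt; rewrite linearZr_LR /= linearBr linear_sumr.
rewrite (bigD1 (Ordinal ilt)) //= big1 ?addr0.
  by rewrite linearZr_LR /= gn // eqxx mulr1 subrr mulr0.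
by move=> j; rewrite -val_eqE /= => ji; rewrite linearZr_LR /= gn // eq_sym (negPf ji) mulr0.
Qed.

(** Expanding [n.+1] basis vectors in [n] vectors gives a matrix with more rows than columns; a
    nonzero row vector in its left kernel is a linear relation among the basis vectors. *)
Lemma infinite_dim_not_spanned n (b : 'I_n -> V) : countably_infinite_dim V ->
  exists v, forall c : 'I_n -> K, v <> \sum_i c i *: b i.
Proof.
move=> [e [e_free _]]; apply: contrapT => h.
have /choice[A AE] : forall i : 'I_n.+1, exists c : 'I_n -> K, e i = \sum_j c j *: b j.
  move=> i; apply: contrapT => h1; apply: h; exists (e i) => c E.
  by apply: h1; exists c.
pose M := \matrix_(i, j) A i j.
have : kermx M != 0.
  rewrite kermx_eq0 /row_free neq_ltn; apply/orP; left.
  by rewrite ltnS rank_leq_col.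
case/rowV0Pn => c /sub_kermxP cM /eqP[].
apply/rowP => i; rewrite mxE; apply: (e_free _ (fun i => c 0 i)).
under eq_bigr do rewrite AE scaler_sumr.
rewrite exchange_big /= big1 // => j _.
under eq_bigr do rewrite scalerA.
rewrite -scaler_suml; have /rowP/(_ j) := cM; rewrite !mxE => E.
suff -> : \sum_(i < n.+1) c 0 i * A i j = 0 by rewrite scale0r.
by rewrite -[RHS]E; apply: eq_bigr => k _; rewrite !mxE.
Qed.

Lemma dual_system_extend g n v : countably_infinite_dim V ->
  (forall v, (forall w, pair v w = 0) -> v = 0) -> dual_system g n ->
  exists p, let g' := fun i => if i == n then p else g i in
    dual_system g' n.+1 /\ v = dual_proj g' n.+1 v.
Proof.
move=> infV nondeg gn.
(* The vector to adjoin is [v] itself unless the system already captures it; then any vector outside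
   the span serves to lengthen the system. *)
have [v' [v'g v'E]] : exists v', v' != dual_proj g n v' /\
    (v != dual_proj g n v -> v' = v).
  have [vE|] := eqVneq v (dual_proj g n v); last by exists v.
  have [v' h] := infinite_dim_not_spanned (fun i : 'I_n => (g i).1) infV.
  by exists v'; split=> //; apply/eqP; apply: h.
have [w [gw rw]] := dual_system_covector nondeg gn v'g.
exists (v' - dual_proj g n v', w) => g'.
have g'E i : (i < n)%N -> g' i = g i by move=> ilt; rewrite /g' ltn_eqF.
have g'n : g' n = (v' - dual_proj g n v', w) by rewrite /g' eqxx.
split=> [i j|].
  rewrite !ltnS (leq_eqVlt i) (leq_eqVlt j).
  move=> /orP[/eqP->|ilt] /orP[/eqP->|jlt].
  - by rewrite g'n eqxx.
  - by rewrite g'n g'E //= linearBl pair_dual_proj // subrr gtn_eqF.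
  - by rewrite g'n g'E //= gw // ltn_eqF.
  - by rewrite !g'E // gn.
have -> : dual_proj g' n.+1 v = dual_proj g n v + pair v w *: (v' - dual_proj g n v').
  rewrite /dual_proj big_ord_recr /= g'n /=; congr (_ + _).
  by apply: eq_bigr => i _; rewrite g'E.
have [vE|/[dup] vg /v'E v'v] := eqVneq v (dual_proj g n v).
  by rewrite {3}vE pair_dual_proj0 // scale0r addr0.
subst v'; have -> : pair v w = 1; last by rewrite scale1r addrC subrK.
by rewrite -rw linearBl pair_dual_proj0 // subr0.
Qed.

End DualSystems.

Section DualBases.
Context {K : closedFieldType} {V Vs : lmodType K}.
Variable pair : {bilinear V -> Vs -> K | *%R & *%R}.

(** Exchanging the two sides lets the extension lemma capture covectors as well as vectors. *)
Definition flip_pair (w : Vs) (v : V) : K := pair v w.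

Fact flip_pair_bilinear : bilinear_for *%R *%R flip_pair.
Proof.
by split=> [v|w] a x y; rewrite /flip_pair ?linearPl ?linearPr.
Qed.
HB.instance Definition _ :=
  bilinear_isBilinear.Build K Vs V K *%R *%R flip_pair flip_pair_bilinear.


Lemma dual_system_flip g n :
  dual_system flip_pair (fun i => ((g i).2, (g i).1)) n <-> dual_system pair g n.
Proof.
by split=> h i j il jl; have := h j i jl il; rewrite /flip_pair /= eq_sym.
Qed.

Lemma eq_dual_system (p : {bilinear V -> Vs -> K | *%R & *%R}) g h n :
  (forall i, (i < n)%N -> g i = h i) -> dual_system p g n -> dual_system p h n.
Proof. by move=> E gn i j il jl; rewrite -!E // gn. Qed.

(* Once [v] lies in the span of the first [n] vectors of a dual system, its
   coordinates on the later ones vanish. *)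
Lemma dual_proj_stable (p : {bilinear V -> Vs -> K | *%R & *%R}) g n m v :
  (forall k, dual_system p g k) -> v = dual_proj p g n v -> (n <= m)%N ->
  v = dual_proj p g m v.
Proof.
move=> gd vE /subnK <-; elim: (m - n)%N => // k IH.
rewrite addSn /dual_proj big_ord_recr /= -/(dual_proj p g _ v) -IH.
have -> : p v (g (k + n)%N).2 = 0; last by rewrite scale0r addr0.
rewrite vE pair_dual_proj0 // => i ilt; have lekn := leq_addl k n.
by rewrite (gd (k + n).+1) ?ltnS ?(leq_trans (ltnW ilt)) // ltn_eqF // (leq_trans ilt).
Qed.

End DualBases.

Section DualBasesExist.
Context {K : closedFieldType} {V Vs : lmodType K}.
Variable pair : {bilinear V -> Vs -> K | *%R & *%R}.

(** Asking for the expansion at every [n] past some [N] expresses finite support and lets several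
    expansions share one bound. *)
Definition dual_bases (e : nat -> V) (f : nat -> Vs) : Prop :=
  [/\ forall i j, pair (e i) (f j) = (i == j)%:R,
      forall v, exists N, forall n, (N <= n)%N ->
        v = \sum_(i < n) pair v (f i) *: e i &
      forall w, exists N, forall n, (N <= n)%N ->
        w = \sum_(i < n) pair (e i) w *: f i].

Lemma eventually_subspace (M : lmodType K) (F : nat -> M -> M) :
  (forall n, linear (F n)) ->
  is_subspace [set m | exists N, forall n, (N <= n)%N -> m = F n m].
Proof.
move=> lF; split.
  exists 0%N => n _; have := lF n (-1) 0 0.
  by rewrite scaler0 add0r scaleN1r => ->; rewrite addNr.
move=> a x y [N1 h1] [N2 h2]; exists (maxn N1 N2) => n.
by rewrite geq_max => /andP[/h1 E1 /h2 E2]; rewrite lF -E1 -E2.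
Qed.

(* The vectors of the two given bases are treated alternately, each step adding
   one dual pair whose span captures the next of them. *)
Lemma dual_bases_exist : countably_infinite_dim V -> countably_infinite_dim Vs ->
  nondegenerate_pairing pair -> exists e f, dual_bases e f.
Proof.
move=> infV infVs [ndV ndVs].
have [a [_ aspan]] := infV; have [b [_ bspan]] := infVs.
(* [F] chooses the next pair from a partial system and its length: even lengths capture a vector of
   [a], odd lengths one of [b]. On input that is not a dual system the value is arbitrary. *)
have /choice[F FP] : forall gn : (nat -> V * Vs) * nat, exists p,
    let g' := fun i => if i == gn.2 then p else gn.1 i in
    dual_system pair gn.1 gn.2 -> dual_system pair g' gn.2.+1 /\
    (if odd gn.2 then
       b gn.2./2 = dual_proj (flip_pair pair)
         (fun i => ((g' i).2, (g' i).1)) gn.2.+1 (b gn.2./2)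
     else a gn.2./2 = dual_proj pair g' gn.2.+1 (a gn.2./2)).
  move=> [g n]; have [gn|] := pselect (dual_system pair g n); last by exists (0, 0).
  have gn' := gn; move/dual_system_flip in gn'.
  case: (odd n) => /=; last first.
    by have [p [h1 h2]] := dual_system_extend (a n./2) infV ndV gn; exists p.
  have [p [h1 h2]] := dual_system_extend (pair := flip_pair pair) (b n./2) infVs ndVs gn'.
  have E : (fun i => if i == n then p else ((g i).2, (g i).1)) =
           (fun i => let q := if i == n then (p.2, p.1) else g i in (q.2, q.1)).
    by apply/funext => i; case: ifP => //; case: p {h1 h2}.
  exists (p.2, p.1) => _; split; last by rewrite E in h2.
  by apply/dual_system_flip; rewrite E in h1.
(* Stage [n] is a whole sequence whose first [n] entries are final, so the limit [g] can be read off
   the diagonal. *)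
pose S := fix S n := if n is n'.+1 then
  fun i => if i == n' then F (S n', n') else S n' i else fun=> (0, 0).
pose g i := S i.+1 i.
have SE n i : (i < n)%N -> S n i = g i.
  elim: n => // n IH; rewrite ltnS leq_eqVlt => /orP[/eqP->|/[dup] ilt /IH <-] //=.
  by rewrite (ltn_eqF ilt).
have Sd n : dual_system pair (S n) n by elim: n => // n IH; have [] := FP (S n, n) IH.
have gd n : dual_system pair g n by apply: eq_dual_system (Sd n); apply: SE.
pose g' i := ((g i).2, (g i).1).
have gd' n : dual_system (flip_pair pair) g' n by apply/dual_system_flip.
have aE k : a k = dual_proj pair g (k.*2.+1) (a k).
  have [_] := FP (S k.*2, k.*2) (Sd _); rewrite /= odd_double doubleK => {1}->.
  by apply: eq_bigr => i _; have := SE k.*2.+1 i (ltn_ord i) => /= ->.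
have bE k : b k = dual_proj (flip_pair pair) g' (k.*2.+2) (b k).
  have [_] := FP (S k.*2.+1, k.*2.+1) (Sd _).
  rewrite /= odd_double /= uphalf_double => {1}->.
  by apply: eq_bigr => i _; have := SE k.*2.+2 i (ltn_ord i) => /= ->.
exists (fun i => (g i).1), (fun i => (g i).2); split.
- move=> i j; apply: (gd (maxn i j).+1); rewrite ltnS; [exact: leq_maxl|exact: leq_maxr].
- pose S1 := [set v | exists N, forall n, (N <= n)%N -> v = dual_proj pair g n v].
  have hS : is_subspace S1.
    apply: eventually_subspace => k x u v; rewrite /dual_proj scaler_sumr -big_split.
    by apply: eq_bigr => i _; rewrite linearPl scalerDl scalerA.
  move=> v; change (S1 v); have [n [c ->]] := aspan v.
  apply: (subspace_sum _ hS) => i _; apply: (subspaceZ _ hS).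
  by exists i.*2.+1 => m; apply: dual_proj_stable gd (aE i).
- pose S2 := [set w | exists N, forall n, (N <= n)%N ->
    w = dual_proj (flip_pair pair) g' n w].
  have hS : is_subspace S2.
    apply: eventually_subspace => k x u v; rewrite /dual_proj scaler_sumr -big_split.
    by apply: eq_bigr => i _; rewrite linearPl scalerDl scalerA.
  move=> w; change (S2 w); have [n [c ->]] := bspan w.
  apply: (subspace_sum _ hS) => i _; apply: (subspaceZ _ hS).
  by exists i.*2.+2 => m; apply: dual_proj_stable gd' (bE i).
Qed.

End DualBasesExist.

(** * Coordinates in the tensor algebra *)

Section SubspaceType.
Variables (K : closedFieldType) (M : lmodType K) (S : set M).
Hypothesis S_subspace : is_subspace S.

(** Carrying the proof as an argument lets the closure instance be attached to this predicate. *)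
Definition subspace_mem of is_subspace S : {pred M} := fun x => `[< S x >].
Let P := subspace_mem S_subspace.

Fact subspace_mem_closed : submod_closed P.
Proof.
split=> [|a x y /asboolP Sx /asboolP Sy]; apply/asboolP; first exact: subspace0.
by apply: S_subspace.2.
Qed.
HB.instance Definition _ :=
  GRing.isSubmodClosed.Build K M P subspace_mem_closed.

Record subspace_type := SubspaceType {subspace_val : M; _ : subspace_val \in P}.
HB.instance Definition _ := [isSub for subspace_val].
HB.instance Definition _ := [Choice of subspace_type by <:].
HB.instance Definition _ := [SubChoice_isSubLmodule of subspace_type by <:].

(** The universal property of the tensor product quantifies over module types, so a subspace must
    become a type before it can be a target. *)
Lemma subspace_as_lmodType : exists (U : lmodType K) (i : {linear U -> M}),
  injective i /\ forall x, S x <-> exists u, i u = x.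
Proof.
exists subspace_type, (val : {linear subspace_type -> M}); split; first exact: val_inj.
move=> x; split=> [Sx|[u <-]]; last by apply/asboolP; exact: (valP u).
by exists (SubspaceType (asboolT Sx : x \in P)).
Qed.

End SubspaceType.

(** * Pure tensors and the actions *)

Section Tensors.
Context {K : closedFieldType} {V Vs : lmodType K}.
Context {pair : {bilinear V -> Vs -> K | *%R & *%R}}.
Context {gl : tensor_algebra pair}.

(** The universal map into the span of the pure tensors, followed by the inclusion, fixes every pure
    tensor; by uniqueness it is the identity. *)
Lemma span_tens (x : gl) : span [set z | exists v w, z = tens gl v w] x.
Proof.
set S := span _.
have [U [i [i_inj iP]]] := subspace_as_lmodType (span_subspace _ : is_subspace S).
have /choice[f fE] : forall vw, exists u, i u = tens gl vw.1 vw.2.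
  by move=> vw; apply/iP; apply: subset_span; exists vw.1, vw.2.
have f_bilinear : bilinear_for *:%R *:%R (fun v w => f (v, w)).
  by split=> [w|v] a u1 u2; apply: i_inj;
    rewrite !(linearP, fE) /= ?linearPl ?linearPr.
pose B := bilinear_isBilinear.Build _ _ _ _ _ _ _ f_bilinear.
pose F : {bilinear V -> Vs -> U} := HB.pack (fun v w => f (v, w)) B.
have [[g gE] _] := @tensP _ _ _ _ gl _ F.
have [_ uniq_lin] := @tensP _ _ _ _ gl _ (tens gl).
pose g1 : {linear gl -> gl} := i \o g.
pose g2 : {linear gl -> gl} := idfun.
have E : g1 =1 g2 by apply: uniq_lin => v w //=; rewrite gE /= fE.
by apply/iP; exists (g x); rewrite -[RHS]/(g2 x) -E.
Qed.

Lemma tens_ind (P : set gl) : is_subspace P -> (forall v w, P (tens gl v w)) ->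
  forall x, P x.
Proof.
by move=> hP h x; apply: (span_min hP _ (span_tens x)) => _ [v [w ->]].
Qed.


Local Notation "x ** y" := (tmul gl x y) (at level 40, left associativity).

Lemma act_mul (x y : gl) v : actV gl (x ** y) v = actV gl x (actV gl y v).
Proof.
move: x; apply: (tens_ind (P := [set x |
  actV gl (x ** y) v = actV gl x (actV gl y v)])).
  split=> [|a x1 x2 h1 h2] /=; first by rewrite !linear0l.
  by rewrite !linearPl h1 h2.
move=> v1 w1 /=.
move: y; apply: (tens_ind (P := [set y |
  actV gl (tens gl v1 w1 ** y) v = actV gl (tens gl v1 w1) (actV gl y v)])).
  split=> [|a x1 x2 h1 h2] /=; first by rewrite ?linear0r ?linear0l ?linear0r.
  by rewrite linearPr !linearPl linearPr h1 h2.
move=> v2 w2 /=; rewrite tmulE linearZl_LR /= !actVE linearZl_LR /= scalerA.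
by rewrite mulrC.
Qed.

Lemma pair_act (x : gl) v w : pair (actV gl x v) w = - pair v (actVs gl x w).
Proof.
move: x; apply: (tens_ind (P := [set x | pair (actV gl x v) w = - pair v (actVs gl x w)])).
  split=> [|a x1 x2 h1 h2] /=; first by rewrite ?linear0r ?linear0l ?linear0r oppr0.
  by rewrite !(linearPl, linearPr) /= h1 h2 opprD mulrN.
move=> v1 w1 /=; rewrite actVE actVsE linearZl_LR /= linearNr linearZr_LR /= opprK.
exact: mulrC.
Qed.

Lemma mul_tens_l (x : gl) v w : x ** tens gl v w = tens gl (actV gl x v) w.
Proof.
move: x; apply: (tens_ind (P := [set x | x ** tens gl v w = tens gl (actV gl x v) w])).
  by split=> [|a x1 x2 h1 h2] /=; rewrite ?linear0l // !linearPl h1 h2.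
by move=> v1 w1 /=; rewrite tmulE actVE linearZl_LR.
Qed.

Lemma mul_tens_r (x : gl) v w : tens gl v w ** x = - tens gl v (actVs gl x w).
Proof.
move: x; apply: (tens_ind (P := [set x | tens gl v w ** x = - tens gl v (actVs gl x w)])).
  split=> [|a x1 x2 h1 h2] /=; first by rewrite ?linear0r ?linear0l ?linear0r oppr0.
  by rewrite !linearPr linearPl linearPr h1 h2 opprD scalerN.
by move=> v1 w1 /=; rewrite tmulE actVsE linearNr linearZr_LR opprK.
Qed.

Lemma bracket_tens (x : gl) v w : bracket x (tens gl v w) =
  tens gl (actV gl x v) w + tens gl v (actVs gl x w).
Proof. by rewrite /bracket mul_tens_l mul_tens_r opprK. Qed.

Lemma sl_bracket (x y : gl) : sl (bracket x y).
Proof. by apply: subset_span; exists x, y. Qed.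

Lemma sl_subspace : is_subspace (@sl K V Vs pair gl).
Proof. exact: span_subspace. Qed.

(** The element is the bracket of [tens gl v1 w2] and [tens gl v2 w1]. *)
Lemma sl_tens_sub v1 w1 v2 w2 : pair v2 w2 = 1 ->
  sl (tens gl v1 w1 - pair v1 w1 *: tens gl v2 w2).
Proof.
move=> h; have := sl_bracket (tens gl v1 w2) (tens gl v2 w1).
by rewrite /bracket !tmulE h scale1r.
Qed.

End Tensors.

(** * Finite matrices in a pair of dual bases *)

Section Coordinates.
Context {K : closedFieldType} {V Vs : lmodType K}.
Context {pair : {bilinear V -> Vs -> K | *%R & *%R}}.
Context {gl : tensor_algebra pair} {e : nat -> V} {f : nat -> Vs}.
Hypothesis ef : dual_bases pair e f.

Local Notation "x ** y" := (tmul gl x y) (at level 40, left associativity).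

Let pair_ef i j : pair (e i) (f j) = (i == j)%:R.
Proof. by have [] := ef. Qed.

Lemma tens_expand (x : gl) : exists N, forall n, (N <= n)%N ->
  x = \sum_(j < n) tens gl (actV gl x (e j)) (f j).
Proof.
have [_ _ espan] := ef; pose S := [set x | exists N, forall n, (N <= n)%N ->
  x = \sum_(j < n) tens gl (actV gl x (e j)) (f j)].
apply: (tens_ind (P := S)).
  apply: (eventually_subspace (F := fun n x => \sum_(j < n) tens gl (actV gl x (e j)) (f j))).
  move=> n a x1 x2; rewrite scaler_sumr -big_split; apply: eq_bigr => i _.
  by rewrite !linearPl.
move=> v w; have [N hN] := espan w; exists N => n /hN wE.
under eq_bigr do rewrite actVE linearZl_LR -linearZr_LR /=.
by rewrite -linear_sumr -wE.
Qed.

(** An element is recovered from its values on the basis [e]. Identities in [gl], such as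
    associativity, can therefore be checked on [V]. *)
Lemma act_faithful (x y : gl) : (forall v, actV gl x v = actV gl y v) -> x = y.
Proof.
move=> h; have [N1 h1] := tens_expand x; have [N2 h2] := tens_expand y.
rewrite (h1 (maxn N1 N2)) ?leq_maxl // [RHS](h2 (maxn N1 N2)) ?leq_maxr //.
by apply: eq_bigr => i _; rewrite h.
Qed.

Lemma tmulA (x y z : gl) : x ** (y ** z) = x ** y ** z.
Proof. by apply: act_faithful => v; rewrite !act_mul. Qed.

Definition embed n (M : 'M[K]_n) : gl := \sum_i \sum_j M i j *: tens gl (e i) (f j).
Definition coords n (x : gl) : 'M[K]_n := \matrix_(i, j) pair (actV gl x (e j)) (f i).
(** The matrix of [x] lives in the upper left corner of size [n]. *)
Definition supp n (x : gl) := x = embed (coords n x).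

Fact emb_linear n : linear (@embed n).
Proof.
move=> a M N; rewrite /embed scaler_sumr -big_split; apply: eq_bigr => i _ /=.
rewrite scaler_sumr -big_split; apply: eq_bigr => j _ /=.
by rewrite !mxE scalerDl scalerA.
Qed.
HB.instance Definition _ n :=
  GRing.isLinear.Build K 'M[K]_n gl *:%R (@embed n) (@emb_linear n).

Fact coords_linear n : linear (@coords n).
Proof. by move=> a x y; apply/matrixP => i j; rewrite !mxE linearPl linearPl. Qed.
HB.instance Definition _ n :=
  GRing.isLinear.Build K gl 'M[K]_n *:%R (@coords n) (@coords_linear n).

Lemma act_emb n (M : 'M_n) v :
  actV gl (embed M) v = \sum_i \sum_j (M i j * pair v (f j)) *: e i.
Proof.
rewrite linear_sumlz; apply: eq_bigr => i _; rewrite linear_sumlz.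
by apply: eq_bigr => j _; rewrite linearZl_LR /= actVE scalerA.
Qed.

Lemma act_emb_basis n (M : 'M_n) (j : 'I_n) : actV gl (embed M) (e j) = \sum_i M i j *: e i.
Proof.
rewrite act_emb; apply: eq_bigr => i _; rewrite (bigD1 j) //= big1.
  by rewrite addr0 pair_ef eqxx mulr1.
by move=> k kj; rewrite pair_ef eq_sym val_eqE (negPf kj) mulr0 scale0r.
Qed.

Lemma coords_emb n (M : 'M_n) : coords n (embed M) = M.
Proof.
apply/matrixP => i j; rewrite !mxE act_emb_basis linear_sumlz (bigD1 i) //= big1.
  by rewrite addr0 linearZl_LR /= pair_ef eqxx mulr1.
by move=> k ki; rewrite linearZl_LR /= pair_ef val_eqE (negPf ki) mulr0.
Qed.

Lemma supp_emb n (M : 'M_n) : supp n (embed M).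
Proof. by rewrite /supp coords_emb. Qed.

Lemma emb_mul n (M N : 'M_n) : embed M ** embed N = embed (M *m N).
Proof.
rewrite {1}/embed linear_sumlz; apply: eq_bigr => i _.
rewrite linear_sumlz; under eq_bigr do rewrite linearZl_LR linear_sumr scaler_sumr.
transitivity (\sum_j \sum_k (M i j * N j k) *: tens gl (e i) (f k)).
  apply: eq_bigr => j _; rewrite (bigD1 j) //= [X in _ + X]big1 ?addr0.
    rewrite linear_sumr scaler_sumr; apply: eq_bigr => k _.
    by rewrite linearZr_LR /= tmulE pair_ef eqxx scale1r scalerA.
  move=> k kj; rewrite linear_sumr big1 ?scaler0 // => l _.
  by rewrite linearZr_LR /= tmulE pair_ef val_eqE (negPf kj) scale0r scaler0.
rewrite exchange_big; apply: eq_bigr => k _; rewrite -scaler_suml.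
by congr (_ *: _); rewrite mxE.
Qed.

Lemma supp_subspace n : is_subspace [set x | supp n x].
Proof.
split=> [|a x y] /=; rewrite /supp; first by rewrite !linear0.
by move=> hx hy; rewrite [coords _ _]linearP [embed _]linearP /= -hx -hy.
Qed.

Lemma supp_mul n x y : supp n x -> supp n y -> supp n (x ** y).
Proof. by move=> -> ->; rewrite emb_mul; apply: supp_emb. Qed.

Lemma coords_mul n x y : supp n x -> supp n y ->
  coords n (x ** y) = coords n x *m coords n y.
Proof. by move=> hx hy; rewrite {1}hx {1}hy emb_mul coords_emb. Qed.

Lemma supp_bracket n x y : supp n x -> supp n y -> supp n (bracket x y).
Proof.
move=> hx hy; rewrite /bracket.
by apply: (subspaceB (@supp_subspace n)); apply: supp_mul.
Qed.

Lemma coords_bracket n x y : supp n x -> supp n y ->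
  coords n (bracket x y) = coords n x *m coords n y - coords n y *m coords n x.
Proof. by move=> hx hy; rewrite /bracket linearB /= !coords_mul. Qed.

Lemma supp_tens n i j : (i < n)%N -> (j < n)%N -> supp n (tens gl (e i) (f j)).
Proof.
move=> il jl; rewrite /supp /embed (bigD1 (Ordinal il)) //= [X in _ + X]big1 ?addr0.
  rewrite (bigD1 (Ordinal jl)) //= big1 ?addr0.
    by rewrite mxE actVE linearZl_LR /= !pair_ef !eqxx mulr1 scale1r.
  move=> k kj; rewrite mxE actVE linearZl_LR /= !pair_ef.
  by move: kj; rewrite -val_eqE /= => /negPf ->; rewrite mul0r scale0r.
move=> k kj; rewrite big1 // => l _; rewrite mxE actVE linearZl_LR /= !pair_ef.
by move: kj; rewrite -val_eqE /= eq_sym => /negPf ->; rewrite mulr0 scale0r.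
Qed.

Lemma supp_le n m x : (n <= m)%N -> supp n x -> supp m x.
Proof.
move=> nm ->; apply: (subspace_sum _ (@supp_subspace m)) => i _.
apply: (subspace_sum _ (@supp_subspace m)) => j _.
apply: (subspaceZ _ (@supp_subspace m)).
by apply: supp_tens; apply: leq_trans nm.
Qed.

Lemma supp_exists x : exists n, supp n x.
Proof.
suff : exists N, forall n, (N <= n)%N -> supp n x by move=> [N h]; exists N; apply: h.
pose S := [set x | exists N, forall n, (N <= n)%N -> x = embed (coords n x)].
move: x; apply: (tens_ind (P := S)).
  apply: (eventually_subspace (F := fun n x => embed (coords n x))) => n a x y.
  by rewrite !linearP.
have [_ vspan wspan] := ef.
move=> v w; have [N1 h1] := vspan v; have [N2 h2] := wspan w.
exists (maxn N1 N2) => n; rewrite geq_max => /andP[/h1 vE /h2 wE].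
rewrite {1}vE linear_sumlz /embed; apply: eq_bigr => i _.
rewrite {1}wE linearZl_LR linear_sumr scaler_sumr; apply: eq_bigr => j _.
by rewrite mxE actVE linearZr_LR !linearZl_LR /= scalerA mulrC.
Qed.

Lemma act_supp n x j : supp n x -> (n <= j)%N -> actV gl x (e j) = 0.
Proof.
move=> -> nj; rewrite act_emb big1 // => i _; rewrite big1 // => k _.
by rewrite pair_ef gtn_eqF ?mulr0 ?scale0r // (leq_trans _ nj).
Qed.

Lemma coact_supp n x j : supp n x -> (n <= j)%N -> actVs gl x (f j) = 0.
Proof.
move=> -> nj; rewrite linear_sumlz big1 // => i _; rewrite linear_sumlz big1 // => k _.
by rewrite linearZl_LR /= actVsE pair_ef ltn_eqF ?scale0r ?oppr0 ?scaler0 // (leq_trans _ nj).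
Qed.

Lemma tr_coords_le n m x : (n <= m)%N -> supp n x -> \tr (coords m x) = \tr (coords n x).
Proof.
move=> nm hx; rewrite /mxtrace.
transitivity (\sum_(i < m) pair (actV gl x (e i)) (f i)).
  by apply: eq_bigr => i _; rewrite mxE.
transitivity (\sum_(i < n) pair (actV gl x (e i)) (f i)); last first.
  by apply: eq_bigr => i _; rewrite mxE.
rewrite (big_ord_widen m (fun i => pair (actV gl x (e i)) (f i)) nm) [RHS]big_mkcond.
apply: eq_bigr => i _; case: ltnP => // ni.
by rewrite (act_supp hx ni) linear0l.
Qed.

Lemma tr_coords_eq n m x : supp n x -> supp m x -> \tr (coords m x) = \tr (coords n x).
Proof.
move=> hn hm; have [nm|mn] := leqP n m; first exact: tr_coords_le.
by rewrite (tr_coords_le (ltnW mn)).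
Qed.

Lemma emb1_mul n x : supp n x -> embed (1%:M : 'M_n) ** x = x.
Proof. by move=> hx; rewrite {2}hx hx emb_mul mul1mx coords_emb. Qed.

Lemma mul_emb1 n x : supp n x -> x ** embed (1%:M : 'M_n) = x.
Proof. by move=> hx; rewrite {2}hx hx emb_mul mulmx1 coords_emb. Qed.

Lemma exists_common_supp (x y : gl) : exists n, supp n x /\ supp n y.
Proof.
have [n hn] := supp_exists x; have [m hm] := supp_exists y; exists (maxn n m).
by split; [apply: supp_le hn; exact: leq_maxl | apply: supp_le hm; exact: leq_maxr].
Qed.

(** Von Neumann regularity, inherited from matrices through a generalized inverse in a corner
    containing [z]. *)
Lemma tmul_regular (z : gl) : exists r, z = z ** r ** z.
Proof.
have [n hz] := supp_exists z; exists (embed (pinvmx (coords n z))).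
by rewrite hz !emb_mul coords_emb mulmxKpV.
Qed.

Lemma sl_tr n x : sl x -> supp n x -> \tr (coords n x) = 0.
Proof.
move=> slx hx; suff [m hm tr0] : exists2 m, supp m x & \tr (coords m x) = 0.
  by rewrite (tr_coords_eq hm hx).
move: slx; apply: (span_min (S := [set x | exists2 m, supp m x & \tr (coords m x) = 0])).
  split; first by exists 0%N; [exact: (supp_subspace 0).1 | rewrite /mxtrace big_ord0].
  move=> a y1 y2 [m1 h1 t1] [m2 h2 t2]; exists (maxn m1 m2).
    apply: (supp_subspace _).2; first by apply: supp_le h1; exact: leq_maxl.
    by apply: supp_le h2; exact: leq_maxr.
  rewrite [coords _ _]linearP raddfD /= mxtraceZ (tr_coords_le _ h1) ?leq_maxl //.
  by rewrite (tr_coords_le _ h2) ?leq_maxr // t1 t2 mulr0 addr0.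
move=> _ [y1 [y2 ->]]; have [m [h1 h2]] := exists_common_supp y1 y2.
exists m; first exact: supp_bracket.
by rewrite coords_bracket // raddfB /= mxtrace_mulC subrr.
Qed.

Lemma tr_sl n x : supp n x -> \tr (coords n x) = 0 -> sl x.
Proof.
move=> hx tr0; have e00 : pair (e 0) (f 0) = 1 by rewrite pair_ef.
(* Each matrix unit is moved into [sl] by a multiple of [tens gl (e 0) (f 0)]; the corrections add
   up to the trace, which is zero. *)
have -> : x = \sum_(i < n) \sum_(j < n) coords n x i j *:
    (tens gl (e i) (f j) - pair (e i) (f j) *: tens gl (e 0) (f 0)).
  transitivity (x - \tr (coords n x) *: tens gl (e 0) (f 0)).
    by rewrite tr0 scale0r subr0.
  rewrite {1}hx /embed /mxtrace scaler_suml -sumrB; apply: eq_bigr => i _.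
  under [RHS]eq_bigr do rewrite scalerBr scalerA.
  rewrite sumrB; congr (_ - _); rewrite (bigD1 i) //= big1 ?addr0.
    by rewrite pair_ef eqxx mulr1.
  by move=> j ji; rewrite pair_ef val_eqE eq_sym (negPf ji) mulr0 scale0r.
apply: (subspace_sum _ sl_subspace) => i _.
apply: (subspace_sum _ sl_subspace) => j _.
by apply: (subspaceZ _ sl_subspace); apply: sl_tens_sub.
Qed.

Lemma sl_tens v w : pair v w = 0 -> sl (tens gl v w).
Proof.
move=> vw; have e00 : pair (e 0) (f 0) = 1 by rewrite pair_ef.
by have := sl_tens_sub (gl := gl) v w e00; rewrite vw scale0r subr0.
Qed.

(** The rectangular identity matrix: it pads by zeros when [n <= m] and truncates when [m <= n]. *)
Definition padding m n : 'M[K]_(m, n) := \matrix_(i, k) (i == k :> nat)%:R.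

Lemma coords_padding n m x : supp n x ->
  coords m x = padding m n *m coords n x *m (padding m n)^T.
Proof.
move=> hx.
apply/matrixP => i j; rewrite [RHS]mxE; under [RHS]eq_bigr do rewrite !mxE big_distrl.
  rewrite exchange_big mxE {1}hx act_emb linear_sumlz; apply: eq_bigr => k _.
  rewrite linear_sumlz; apply: eq_bigr => l _.
  rewrite linearZl_LR /= !pair_ef !mxE mulrC mulrA.
  by rewrite [k == i :> nat]eq_sym.
Qed.

Lemma rank_coords_le n m x : supp n x -> (\rank (coords m x) <= \rank (coords n x))%N.
Proof.
move=> hx; rewrite (coords_padding m hx).
by apply: leq_trans (mxrankM_maxl _ _) _; apply: mxrankM_maxr.
Qed.

(** Take [c] of minimal rank in [P]. The row space of [d ** c] lies in that of [c], and minimality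
    makes them equal, so the rows of [c] are combinations of those of [d ** c]. *)
Lemma left_ideal_minimal (P : set gl) : (exists c, P c) ->
  exists2 c, P c & forall d, P (d ** c) -> exists d', c = d' ** (d ** c).
Proof.
move=> [c0 Pc0]; have [n0 h0] := supp_exists c0.
have exr : exists r, `[< exists c n, [/\ P c, supp n c & \rank (coords n c) = r] >].
  by exists (\rank (coords n0 c0)); apply/asboolP; exists c0, n0.
case: (ex_minnP exr) => r /asboolP[c [n [Pc hc <-]]] rmin; exists c => // d Pdc.
have [m' hm'] := supp_exists d; pose m := maxn n m'.
have hcm : supp m c by apply: supp_le hc; exact: leq_maxl.
have hdm : supp m d by apply: supp_le hm'; exact: leq_maxr.
have le1 : (\rank (coords m c) <= \rank (coords m (d ** c)))%N.
  apply: leq_trans (rank_coords_le m hc) _; apply: rmin; apply/asboolP.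
  by exists (d ** c), m; split=> //; apply: supp_mul.
have /submxP[D E] : (coords m c <= coords m (d ** c))%MS.
  have sub : (coords m (d ** c) <= coords m c)%MS by rewrite coords_mul // submxMl.
  by rewrite -(geq_leqif (mxrank_leqif_sup sub)).
by exists (embed D); rewrite [RHS](congr1 _ (supp_mul hdm hcm)) emb_mul -E.
Qed.

End Coordinates.

(** * Orthogonal projections *)

(** A [{vspace E}] of largest dimension inside [S] exhausts [S], since a vector of [S] outside it
    would enlarge it. *)
Lemma vect_subspace_spanned (K : closedFieldType) (E : vectType K) (S : set E) :
  is_subspace S -> finite_dim S.
Proof.
move=> hS; pose inS (U : {vspace E}) := forall v, v \in U -> S v.
have ex : exists d, `[< exists2 U, inS U & \dim U = d >].
  exists 0%N; apply/asboolP; exists 0%VS; last exact: dimv0.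
  by move=> v; rewrite memv0 => /eqP ->; apply: subspace0.
have bound d : `[< exists2 U, inS U & \dim U = d >] -> (d <= \dim {: E})%N.
  by move=> /asboolP[U _ <-]; apply/dimvS/subvf.
case: (ex_maxnP ex bound) => d /asboolP[U US <-] dmax.
exists (vbasis U); apply/seteqP; split=> v; last first.
  by apply: (span_min hS) => x xU; apply: US; apply: vbasis_mem.
move=> Sv; have vU : v \in U.
  have : (\dim (U + <[v]>) <= \dim U)%N.
    apply: dmax; apply/asboolP; exists (U + <[v]>)%VS => //.
    move=> _ /memv_addP[x xU [_ /vlineP[c ->] ->]].
    by apply: (subspaceD hS); [exact: US | exact: subspaceZ].
  by move/(conj (addvSl U <[v]>))/andP; rewrite -eqEdim => /eqP ->; rewrite memvE addvSr.
rewrite (coord_vbasis vU); apply: (subspace_sum _ (span_subspace _)) => i _.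
apply: (subspaceZ _ (span_subspace _)); apply: subset_span => /=.
by rewrite mem_nth // size_tuple.
Qed.

Section OrthogonalProjection.
Context {K : closedFieldType} {E : lmodType K}.
Variables (h : E -> E -> K) (D : set E).
Hypothesis h_linear : forall z, scalar (h ^~ z).
Hypothesis h_sym : forall x y, h x y = 0 -> h y x = 0.
Hypothesis h_definite : forall x, D x -> h x x = 0 -> x = 0.
Hypothesis D_subspace : is_subspace D.

Lemma h0l z : h 0 z = 0.
Proof. by have := h_linear z (-1) 0 0; rewrite scaler0 addr0 mulN1r addNr. Qed.

Lemma left_orthogonal_subspace x : is_subspace [set z | h z x = 0].
Proof.
split=> [|a y z /= hy hz]; first exact: h0l.
by have := h_linear x a y z; rewrite /= hy hz mulr0 addr0.
Qed.

(** A Hermitian form is only conjugate linear on the right, so the claim is taken from the left side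
    by symmetry of orthogonality. *)
Lemma right_orthogonal_subspace z : is_subspace [set x | h z x = 0].
Proof.
have [h0 hD] := left_orthogonal_subspace z.
by split=> [|a x y /h_sym hx /h_sym hy]; apply: h_sym; [exact: h0 | exact: hD].
Qed.

Lemma orthogonal_projection (b : seq E) y : (forall x, x \in b -> D x) ->
  exists2 m, span [set x | x \in b] m &
    forall x, span [set x | x \in b] x -> h (y - m) x = 0.
Proof.
suff H y' : (forall x, x \in b -> D x) -> exists2 m, span [set x | x \in b] m &
    forall x, x \in b -> h (y' - m) x = 0.
  move=> /(H y)[m hm hb]; exists m => // x; apply: (span_min (right_orthogonal_subspace _)).
  exact: hb.
elim: b y' => [|c b IH] y' Db; first by exists 0; rewrite //; exact: (span_subspace _).1.
have Db' x : x \in b -> D x by move=> xb; apply: Db; rewrite inE xb orbT.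
have spanS x : span [set x | x \in b] x -> span [set x | x \in c :: b] x.
  apply: (span_min (span_subspace _)) => z zb; apply: subset_span.
  by rewrite /= inE zb orbT.
have [m' hm' mb] := IH y' Db'; have [c' hc' cb] := IH c Db'.
have Dc' : D c' by apply: (span_min D_subspace) hc'.
have Dc : D (c - c') by apply: subspaceB => //; apply: Db; rewrite mem_head.
(* Gram-Schmidt: [c1] is the part of [c] orthogonal to [b], and [k] is the coefficient of [y' - m']
   along it. If [h c1 c1 = 0], then [c1 = 0] by definiteness and the value of [k] does not
   matter. *)
pose c1 := c - c'; pose k := h (y' - m') c1 / h c1 c1.
have sc1 : span [set x | x \in c :: b] c1.
  apply: (subspaceB (span_subspace _)); last exact: spanS.
  by apply: subset_span; rewrite /= mem_head.
pose m := k *: c1 + m'; exists m.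
  apply: (subspaceD (span_subspace _)); last exact: spanS.
  exact: (subspaceZ _ (span_subspace _)).
have E1 x : h (y' - m) x = h (y' - m') x - k * h c1 x.
  have -> : y' - m = (- k) *: c1 + (y' - m').
    by rewrite /m opprD scaleNr addrCA addrA.
  by rewrite h_linear mulNr addrC.
have hb x : x \in b -> h (y' - m) x = 0.
  by move=> xb; rewrite E1 mb // cb // mulr0 subrr.
have hc1 : h (y' - m) c1 = 0.
  rewrite E1 /k; have [/(h_definite Dc : h c1 c1 = 0 -> c1 = 0) -> |nz] := eqVneq (h c1 c1) 0.
    by rewrite h0l mulr0 subr0; apply: h_sym; exact: h0l.
  by rewrite divfK // subrr.
move=> x; rewrite inE => /orP[/eqP->|]; last exact: hb.
rewrite -[c](subrK c'); apply: (subspaceD (right_orthogonal_subspace _)) => //=.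
exact: (span_min (right_orthogonal_subspace _)) hc'.
Qed.

End OrthogonalProjection.

(** * Conjugate transposes *)

Section AdjointMatrix.
Variable K : numClosedFieldType.

Definition adjmx m n (A : 'M[K]_(m, n)) : 'M[K]_(n, m) := (map_mx Num.conj A)^T.

Lemma adjmxM m n p (A : 'M[K]_(m, n)) (B : 'M_(n, p)) :
  adjmx (A *m B) = adjmx B *m adjmx A.
Proof. by rewrite /adjmx map_mxM trmx_mul. Qed.

Lemma adjmxK m n (A : 'M[K]_(m, n)) : adjmx (adjmx A) = A.
Proof. by apply/matrixP => i j; rewrite !mxE conjCK. Qed.

Lemma adjmxB m n (A B : 'M[K]_(m, n)) : adjmx (A - B) = adjmx A - adjmx B.
Proof. by rewrite /adjmx map_mxB linearB. Qed.

Lemma tr_adjmx n (A : 'M[K]_n) : \tr (adjmx A) = Num.conj (\tr A).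
Proof.
rewrite /adjmx mxtrace_tr /mxtrace rmorph_sum.
by apply: eq_bigr => i _; rewrite mxE.
Qed.

(** The trace is the sum of the squared absolute values of the entries. *)
Lemma tr_mul_adjmx_eq0 m n (A : 'M[K]_(m, n)) : \tr (A *m adjmx A) = 0 -> A = 0.
Proof.
have nn i j : 0 <= A i j * adjmx A j i by rewrite !mxE mul_conjC_ge0.
move/eqP; rewrite psumr_eq0 => [/allP h|i _]; last by rewrite mxE sumr_ge0.
apply/matrixP => i j; have := h i (mem_index_enum i).
rewrite mxE psumr_eq0 // => /allP/(_ j (mem_index_enum j)).
by rewrite !mxE mul_conjC_eq0 => /eqP.
Qed.

End AdjointMatrix.

(** * Exhaustion by finite traceless matrices *)

Section Exhaustion.
Context {K : numClosedFieldType} {V Vs : lmodType K}.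
Context {pair : {bilinear V -> Vs -> K | *%R & *%R}}.
Context {gl : tensor_algebra pair} {e : nat -> V} {f : nat -> Vs}.
Hypothesis ef : dual_bases pair e f.

Local Notation "x ** y" := (tmul gl x y) (at level 40, left associativity).
Local Notation emb := (@embed _ _ _ _ gl e f _).
Local Notation coords := (@coords _ _ _ _ gl e f).
Local Notation supp := (@supp _ _ _ _ gl e f).

Definition sl_corner n : set gl := [set x | supp n x /\ \tr (coords n x) = 0].

Lemma sl_corner_subspace n : is_subspace (sl_corner n).
Proof.
split=> [|a x y [hx tx] [hy ty]].
  by split; [exact: (@supp_subspace _ _ _ _ gl e f n).1 | rewrite linear0 mxtrace0].
split; first by apply: (@supp_subspace _ _ _ _ gl e f n).2.
by rewrite linearP raddfD /= mxtraceZ tx ty mulr0 addr0.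
Qed.

Lemma sl_corner_bracket n x y : supp n x -> supp n y -> sl_corner n (bracket x y).
Proof.
move=> hx hy; split; first exact: (supp_bracket ef).
by rewrite (coords_bracket ef) // raddfB /= mxtrace_mulC subrr.
Qed.

Lemma sl_corner_le n m : (n <= m)%N -> sl_corner n `<=` sl_corner m.
Proof.
move=> nm x [hx tx]; split; first exact: (supp_le ef nm).
by rewrite (tr_coords_le ef nm).
Qed.

Lemma bigcup_sl_corner : \bigcup_n sl_corner n = sl.
Proof.
apply/seteqP; split=> [x [n _ [hx tx]]|x slx]; first exact: (tr_sl ef hx tx).
have [n hx] := supp_exists ef x; exists n => //; split=> //.
exact: (sl_tr ef slx hx).
Qed.

Lemma supp_finite_dim n (S : set gl) : is_subspace S -> S `<=` [set x | supp n x] ->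
  finite_dim S.
Proof.
move=> hS Sn; have hS' : is_subspace ((@embed _ _ _ _ gl e f n) @^-1` S).
  exact: subspace_preimage.
have [b bE] := vect_subspace_spanned hS'.
exists [seq (emb M : gl) | M <- b]; apply/seteqP; split; last first.
  apply: (span_min hS) => _ /mapP[M Mb ->].
  by change ((emb @^-1` S) M); rewrite bE; apply: subset_span.
set T := span _; have hT : is_subspace ((@embed _ _ _ _ gl e f n) @^-1` T).
  exact: subspace_preimage (span_subspace _).
move=> x Sx; rewrite (Sn _ Sx).
have : (emb @^-1` S) (coords n x) by rewrite /= -(Sn _ Sx).
rewrite bE; apply: (span_min hT) => M Mb.
by rewrite /T; apply: subset_span; apply: map_f.
Qed.

Definition trace_form n (x y : gl) : K := \tr (coords n x *m adjmx (coords n y)).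

Lemma trace_form_linear n z : scalar (trace_form n ^~ z).
Proof.
by move=> a x y; rewrite /trace_form linearP mulmxDl -scalemxAl raddfD /= mxtraceZ.
Qed.

Lemma trace_form_sym n x y : trace_form n x y = 0 -> trace_form n y x = 0.
Proof.
move=> h; rewrite /trace_form -[coords n y]adjmxK -adjmxM tr_adjmx.
by rewrite -/(trace_form n x y) h rmorph0.
Qed.

Lemma trace_form_definite n x : supp n x -> trace_form n x x = 0 -> x = 0.
Proof. by move=> hx /tr_mul_adjmx_eq0 cx; rewrite hx cx linear0. Qed.

Definition star n (x : gl) : gl := emb (adjmx (coords n x)).

Lemma star_sl_corner n x : sl_corner n x -> sl_corner n (star n x).
Proof.
move=> [hx tx]; split; first exact: (supp_emb ef).
by rewrite /star (coords_emb ef) tr_adjmx tx rmorph0.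
Qed.

(** The padding matrix has entries 0 and 1, so its conjugate transpose is its transpose, and
    [star n] can be computed in any other corner. *)
Lemma coords_star n m x : supp n x -> coords m (star n x) = adjmx (coords m x).
Proof.
move=> hx; rewrite (coords_padding ef m hx) (coords_padding ef m (supp_emb ef _)).
rewrite /star (coords_emb ef) !adjmxM mulmxA.
pose P : 'M[K]_(m, n) := padding m n; rewrite -/P.
suff E : adjmx P = P^T.
  have E' : adjmx P^T = P by rewrite -E adjmxK.
  by rewrite E E'.
by apply/matrixP => i j; rewrite !mxE conjC_nat.
Qed.

(* The conjugate transpose preserves the corners, so the orthogonal complement
   of a submodule for the Hermitian form [tr (A B^* )] is again a submodule. *)
Lemma sl_corner_reductive_in n m : (n <= m)%N -> reductive_in (sl_corner n) (sl_corner m).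
Proof.
move=> nm M hM Mm hstab.
have [b bE] : finite_dim M by apply: (supp_finite_dim (n := m) hM) => x /Mm[].
pose N := [set y | sl_corner m y /\ forall x, M x -> trace_form m y x = 0].
have orthS x := left_orthogonal_subspace (@trace_form_linear m) x.
have hN : is_subspace N.
  split=> [|a y z [my hy] [mz hz]].
    by split=> [|x _]; [exact: (sl_corner_subspace m).1 | exact: (orthS x).1].
  split=> [|x Mx]; first exact: (sl_corner_subspace m).2.
  by apply: (orthS x).2; [exact: hy | exact: hz].
exists N; split=> //; first by move=> y [].
  move=> a y na [[ymem ytr] hy]; have [asup atr] := sl_corner_le nm na.
  split; first exact: sl_corner_bracket.
  move=> x Mx; have [xmem _] := Mm x Mx.
  (* By cyclicity of the trace, pairing [bracket a y] with [x] equals pairing [y] with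
     [bracket (star n a) x], and the latter bracket stays in [M]. *)
  have := hy _ (hstab _ _ (star_sl_corner na) Mx); rewrite /trace_form.
  have [sa_supp _] := sl_corner_le nm (star_sl_corner na).
  rewrite !(coords_bracket ef) // coords_star; last by case: na.
  rewrite adjmxB !adjmxM adjmxK mulmxBr mulmxBl !raddfB /=.
  by rewrite -[coords m a *m _ *m _]mulmxA [\tr (coords m a *m _)]mxtrace_mulC !mulmxA.
split; last first.
  apply/seteqP; split=> [x [Mx [_ hx]]|_ ->]; last by split; [exact: hM.1 | exact: hN.1].
  by apply: trace_form_definite (hx x Mx); have [] := Mm x Mx.
apply/seteqP; split=> [y ymem|_ [x Mx [y [ymem _] <-]]]; last first.
  by apply: (subspaceD (sl_corner_subspace m)) => //; exact: Mm.
have bsupp x : x \in b -> supp m x.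
  by move=> xb; have [] // := Mm x; rewrite bE; apply: subset_span.
have [z zM zorth] := orthogonal_projection (@trace_form_linear m) (@trace_form_sym m)
  (@trace_form_definite m) (@supp_subspace _ _ _ _ gl e f m) y bsupp.
rewrite -bE in zM zorth; exists z => //; exists (y - z); last by rewrite addrC subrK.
by split=> //; apply: (subspaceB (sl_corner_subspace m)) => //; exact: Mm.
Qed.

Lemma sl_corner_exhaustion : reductive_exhaustion sl_corner.
Proof.
split=> [n|n|n|]; last exact: bigcup_sl_corner.
- split; last exact: sl_corner_reductive_in.
    split; first exact: sl_corner_subspace.
    by move=> x y [hx _] [hy _]; apply: sl_corner_bracket.
  by apply: (supp_finite_dim (n := n) (sl_corner_subspace n)) => x [].
- exact: sl_corner_le.
- exact: sl_corner_reductive_in.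
Qed.

End Exhaustion.

(** * Semisimple elements are the diagonalizable ones *)

Section Diagonalizable.
Context {K : numClosedFieldType} {V Vs : lmodType K}.
Context {pair : {bilinear V -> Vs -> K | *%R & *%R}}.
Context {gl : tensor_algebra pair} {e : nat -> V} {f : nat -> Vs}.
Hypothesis nondeg : nondegenerate_pairing pair.
Hypothesis ef : dual_bases pair e f.

Local Notation "x ** y" := (tmul gl x y) (at level 40, left associativity).
Local Notation act := (actV gl).
Local Notation coact := (actVs gl).
Local Notation supp := (@supp _ _ _ _ gl e f).

Local Notation sl_corner := (@sl_corner _ _ _ _ gl e f).

(** Diagonalizability on [V], in the form of an annihilating polynomial with simple roots. *)
Definition diag (x : gl) : Prop :=
  exists2 s, uniq s & forall v, shifts (act x) v s = 0.

Lemma tens_eq0 v w : tens gl v w = 0 -> w != 0 -> v = 0.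
Proof.
move=> h w0; have [u uw] : exists u, pair u w != 0.
  apply: contrapT => hu; case/eqP: w0; apply: nondeg.2 => u.
  by apply: contrapT => uw; apply: hu; exists u; apply/eqP.
have := actVE gl v w u; rewrite h linear0l => /esym/eqP.
by rewrite scaler_eq0 (negPf uw) => /eqP.
Qed.

Lemma act_shifts x m v s : act (shifts (tmul gl x) m s) v = shifts (act x) (act m v) s.
Proof.
elim: s => //= a s IH; rewrite -/(shifts _ _ _) {1}/shift linearBl linearZl_LR /=.
by rewrite act_mul IH.
Qed.

Lemma diag_tmul x : diag x -> exists2 s, uniq s & forall m, shifts (tmul gl x) m s = 0.
Proof.
move=> [s us hs]; exists s => // m; apply: (act_faithful ef) => v.
by rewrite act_shifts hs linear0l.
Qed.

(** The two actions are adjoint up to sign, so each root changes sign when a shift crosses the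
    pairing. *)
Lemma pair_shifts x v w s : pair (shifts (act x) v s) w =
  (-1) ^+ size s * pair v (shifts (coact x) w (map -%R s)).
Proof.
elim: s w => [|a s IH] w /=; first by rewrite expr0 mul1r.
rewrite -/(shifts _ _ _) -/(shifts (coact x) _ _) -[shift (coact x) _ _]shifts_shift.
have -> u : pair (shift (act x) a u) w = - pair u (shift (coact x) (- a) w).
  rewrite /shift linearBl linearBr /= pair_act linearZl_LR linearZr_LR /=.
  by rewrite opprB mulNr addrC.
by rewrite IH exprS mulN1r mulNr.
Qed.

Lemma diag_coact x : diag x -> exists2 s, uniq s & forall w, shifts (coact x) w s = 0.
Proof.
move=> [s us hs]; exists (map -%R s); first by rewrite map_inj_uniq //; exact: oppr_inj.
move=> w; apply: nondeg.2 => v; have /esym/eqP := pair_shifts x v w s.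
by rewrite hs linear0l mulf_eq0 signr_eq0 => /eqP.
Qed.

Definition neg_rmul (x m : gl) : gl := - (m ** x).

Fact neg_rmul_linear x : linear (neg_rmul x).
Proof. by move=> a y z; rewrite /neg_rmul linearPl opprD scalerN. Qed.
HB.instance Definition _ x :=
  GRing.isLinear.Build K gl gl *:%R (neg_rmul x) (neg_rmul_linear x).

Fact bracket_linear (x : gl) : linear (bracket x).
Proof.
by move=> a y z; rewrite /bracket linearPl linearPr scalerBr opprD addrACA.
Qed.
HB.instance Definition _ (x : gl) :=
  GRing.isLinear.Build K gl gl *:%R (bracket x) (bracket_linear x).

Lemma diag_neg_rmul x : diag x -> exists2 s, uniq s & forall m, shifts (neg_rmul x) m s = 0.
Proof.
move=> /diag_coact[s us hs]; exists s => //; apply: tens_ind.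
  split=> [|a m1 m2 /= h1 h2]; first exact: shifts0.
  by rewrite shifts_linear h1 h2 scaler0 addr0.
move=> v w; suff -> : shifts (neg_rmul x) (tens gl v w) s = tens gl v (shifts (coact x) w s).
  by rewrite hs linear0r.
elim: s {us hs} => //= a s IH; rewrite -/(shifts _ _ _) IH.
by rewrite {1}/shift /neg_rmul mul_tens_r opprK linearBr linearZr_LR.
Qed.

(** The operator [bracket x] is the sum of left multiplication by [x] and [neg_rmul x], which
    commute by associativity and are both diagonalizable. *)
Lemma diag_bracket x : diag x -> exists2 s, uniq s & forall m, shifts (bracket x) m s = 0.
Proof.
move=> dx; have [s1 us1 h1] := diag_tmul dx; have [s2 us2 h2] := diag_neg_rmul dx.
exists (undup [seq a + b | a <- s1, b <- s2]); first exact: undup_uniq.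
apply: (shiftsD (f := tmul gl x) (g := neg_rmul x)) => // m.
by rewrite /= /neg_rmul linearNr (tmulA ef).
Qed.

Lemma diag_sqr0 x v : diag x -> act x (act x v) = 0 -> act x v = 0.
Proof. by move=> [s us hs]; apply: sqr0_of_shifts (hs v). Qed.

Lemma diag_coact_sqr0 x w : diag x -> coact x (coact x w) = 0 -> coact x w = 0.
Proof. by move=> /diag_coact[s us hs]; apply: sqr0_of_shifts (hs w). Qed.

Lemma diag_scale a x : diag x -> diag (a *: x).
Proof.
move=> [s us hs]; exists (undup (map ( *%R a) s)); first exact: undup_uniq.
move=> v; have hT : is_subspace (@setT V) by [].
apply: (shifts_span (undup_uniq _) _ (span_eigen hT _ us I (hs v))) => // u [_ [b bs xu]].
exists (a * b); first by rewrite mem_undup map_f.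
by rewrite /= linearZl_LR /=; move: xu => /= ->; rewrite scalerA.
Qed.

Lemma diagD x y : diag x -> diag y -> x ** y = y ** x -> diag (x + y).
Proof.
move=> [s1 us1 h1] [s2 us2 h2] xy; exists (undup [seq a + b | a <- s1, b <- s2]).
  exact: undup_uniq.
apply: (shiftsD (f := act x) (g := act y)) => // v; first by rewrite /= linearDl.
by rewrite /= -!act_mul xy.
Qed.

Lemma diag_idem x : x ** x = x -> diag x.
Proof.
move=> xx; exists [:: 0; 1]; first by rewrite /= inE eq_sym oner_neq0.
by move=> v; rewrite /= /shift scale0r scale1r subr0 linearBr /= -act_mul xx subrr.
Qed.

Lemma diag_semisimple x : diag x -> sl x -> semisimple x.
Proof.
move=> /diag_bracket[s us hs] slx; have [N hN] := supp_exists ef x.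
exists sl_corner; split; first exact: (sl_corner_exhaustion ef).
exists N => n Nn; have hn := supp_le ef Nn hN.
split; first by split=> //; exact: (sl_tr ef slx hn).
move=> m hm; have hS := @sl_corner_subspace _ _ _ _ gl e f n.
have stab y : sl_corner n y -> sl_corner n (bracket x y).
  by move=> [hy _]; exact: (sl_corner_bracket ef).
apply: span_min (span_eigen hS _ us hm (hs m)); first exact: span_subspace.
  move=> y [hy [a _ ya]]; apply: subset_span; split=> //; by exists a.
exact: stab.
Qed.

Lemma semisimple_bracket (x m : gl) : semisimple x -> sl m ->
  exists2 s, uniq s & shifts (bracket x) m s = 0.
Proof.
move=> [g [[_ gle _ gU] [N hN]]]; rewrite -gU => -[n _ gm].
have mono k : g n `<=` g (n + k)%N.
  by elim: k => [|k IH]; rewrite ?addn0 // addnS; apply: subset_trans (gle _).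
have [_ ss] := hN (n + N)%N (leq_addl _ _).
apply: span_eigen_shifts; apply: span_min (ss m (mono _ _ gm)); first exact: span_subspace.
by move=> y [_ hy]; apply: subset_span.
Qed.

(** When [x] kills [w], tensoring with [w] intertwines the action of [x] on [V] with [bracket x]. *)
Lemma shifts_bracket_tens x v w s : coact x w = 0 ->
  shifts (bracket x) (tens gl v w) s = tens gl (shifts (act x) v s) w.
Proof.
move=> xw; elim: s => //= a s IH; rewrite -!/(shifts _ _ _) IH /shift bracket_tens xw.
by rewrite linear0r addr0 linearBl linearZl_LR.
Qed.

Lemma semisimple_diag (x : gl) : semisimple x -> diag x.
Proof.
move=> ssx; have [n hx] := supp_exists ef x; have [pef vspan _] := ef.
have fn0 : f n != 0.
  apply/eqP => fn; have := pef n n; rewrite fn linear0r eqxx => /esym/eqP.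
  by rewrite oner_eq0.
have [s us hs] : exists2 s, uniq s & forall i, (i < n)%N -> shifts (act x) (e i) s = 0.
  elim: {-2}n (leqnn n) => [|k IH] kn; first by exists [::].
  have [s1 us1 h1] := IH (ltnW kn).
  have [s2 us2 h2] : exists2 s, uniq s & shifts (act x) (e k) s = 0.
    (* The covector [f n] is the first one beyond the corner of [x]: [x] kills it, and it is
       orthogonal to [e k] because [k < n]. *)
    have slk : sl (tens gl (e k) (f n)) by apply: (sl_tens ef); rewrite pef ltn_eqF.
    have [s us hs] := semisimple_bracket ssx slk; exists s => //.
    apply: tens_eq0 fn0; rewrite -(shifts_bracket_tens _ _ (coact_supp ef hx (leqnn n))).
    exact: hs.
  exists (undup (s1 ++ s2)); first exact: undup_uniq.
  move=> i; rewrite ltnS leq_eqVlt => /orP[/eqP->|ik].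
    by apply: shifts_sub us2 _ h2 => a as2; rewrite mem_undup mem_cat as2 orbT.
  by apply: shifts_sub us1 _ (h1 _ ik) => a as1; rewrite mem_undup mem_cat as1.
(* The root 0 is added for the basis vectors beyond the corner, which [x] kills. *)
have us' := undup_uniq (0 :: s); have ms' := mem_undup (0 :: s).
move: (undup _) us' ms' => s' us' ms'; exists s' => // v.
have hS : is_subspace [set v | shifts (act x) v s' = 0].
  split=> [|a u1 u2 /= h1 h2]; first exact: shifts0.
  by rewrite shifts_linear h1 h2 scaler0 addr0.
have [N /(_ _ (leqnn N)) vE] := vspan v; rewrite vE.
apply: (subspace_sum _ hS) => i _; apply: (subspaceZ _ hS) => /=.
have [ilt|ni] := ltnP i n.
  by apply: shifts_sub us _ (hs _ ilt) => a as_; rewrite ms' inE as_ orbT.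
apply: (@shifts_sub _ _ _ _ [:: 0]) => //.
  by move=> a; rewrite inE => /eqP ->; rewrite ms' mem_head.
by rewrite /= /shift (act_supp ef hx ni) scale0r subr0.
Qed.

End Diagonalizable.

(** * Toral subalgebras *)

Section ToralSubalgebras.
Context {K : numClosedFieldType} {V Vs : lmodType K}.
Context {pair : {bilinear V -> Vs -> K | *%R & *%R}}.
Context {gl : tensor_algebra pair} {e : nat -> V} {f : nat -> Vs}.
Hypothesis nondeg : nondegenerate_pairing pair.
Hypothesis ef : dual_bases pair e f.

Local Notation "x ** y" := (tmul gl x y) (at level 40, left associativity).
Local Notation act := (actV gl).
Local Notation coact := (actVs gl).
Local Notation ten := (tens gl).
Implicit Types (x y z c d m q : gl) (t : set gl).

Lemma coact_mul x y w : coact (x ** y) w = - coact y (coact x w).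
Proof.
apply/eqP; rewrite -subr_eq0 opprK; apply/eqP; apply: nondeg.2 => v.
have h := pair_act (x ** y) v w; rewrite act_mul pair_act pair_act opprK in h.
by rewrite linearDr /= h subrr.
Qed.

Definition cent t : set gl := [set z | forall x, t x -> z ** x = x ** z].

Lemma bracket_eq0 x y : bracket x y = 0 <-> x ** y = y ** x.
Proof. by rewrite /bracket; split=> [/eqP|->]; rewrite ?subrr // subr_eq0 => /eqP. Qed.

Lemma tmul_eq0 x : (forall m, x ** m = 0) -> x = 0.
Proof.
by move=> h; have [n hx] := supp_exists ef x; rewrite -(mul_emb1 ef hx) h.
Qed.

Lemma cent_tmul t x y : cent t x -> cent t y -> cent t (x ** y).
Proof. by move=> hx hy z tz; rewrite -(tmulA ef) hy // !(tmulA ef) hx. Qed.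

Lemma cent_subspace t : is_subspace (cent t).
Proof.
split=> [x _|a x y hx hy z tz]; first by rewrite linear0l linear0r.
by rewrite linearPl linearPr hx // hy.
Qed.

Lemma toral_diag t x : toral_subalgebra t -> t x -> diag x.
Proof. by move=> [_ _ h] /h; apply: (semisimple_diag nondeg ef). Qed.

(** If [bracket x m = a *: m] with [m] in [t], then applying [bracket m] twice to [x] gives 0, and
    semisimplicity of [m] makes [bracket m x] vanish already. *)
Lemma toral_abelian t : toral_subalgebra t -> is_abelian t.
Proof.
move=> tt x y tx ty; have [[tS tbr] _ _] := tt.
have sqr0 u v : t u -> bracket u (bracket u v) = 0 -> bracket u v = 0.
  move=> tu; have [s us hs] := diag_bracket nondeg ef (toral_diag tt tu).
  exact: sqr0_of_shifts us (hs v).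
have bracketC u v : bracket u v = - bracket v u by rewrite /bracket opprB.
have eig m a : t m -> bracket x m = a *: m -> bracket x m = 0.
  move=> tm xm; rewrite bracketC sqr0 ?oppr0 // [bracket m x]bracketC xm.
  by rewrite -scaleNr linearZ /= /bracket subrr scaler0.
have [s us hs] := diag_bracket nondeg ef (toral_diag tt tx).
(* By induction [x] commutes with [shift (bracket x) a m], so [bracket x m] is an eigenvector of
   [bracket x] in [t], to which [eig] applies. *)
move: (hs y) => {us hs}; elim: s y ty => [|a s IH] m tm /=.
  by move=> ->; rewrite linear0.
rewrite -/(shifts _ _ _) -shifts_shift => h; apply: sqr0 => //.
apply: (eig _ a); first exact: tbr.
apply/eqP; rewrite -subr_eq0 -linearZ -linearB; apply/eqP; apply: IH h.
by apply: (subspaceB tS); [exact: tbr | exact: subspaceZ].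
Qed.

(** As [gl] has no unit, a product of factors $y_i - a_i$ needs an element of [t] to start from. *)
Inductive shift_generated t : gl -> Prop :=
| shift_generated_base x : t x -> shift_generated t x
| shift_generated_shift c y a : shift_generated t c -> t y ->
    shift_generated t (shift (tmul gl y) a c).

Section ShiftGenerated.
Variable t : set gl.
Hypothesis t_diag : forall x, t x -> diag x.
Hypothesis t_comm : forall x y, t x -> t y -> x ** y = y ** x.

Lemma shift_generated_comm c m : shift_generated t c -> cent t m -> m ** c = c ** m.
Proof.
move=> gc hm; elim: gc => [x /hm //|c' y a _ IH ty].
rewrite /shift linearBr linearBl linearZr_LR linearZl_LR /= IH.
by rewrite (tmulA ef) hm // -!(tmulA ef) IH.
Qed.

Lemma shift_generated_cent c : shift_generated t c -> cent t c.
Proof.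
by move=> gc x tx; rewrite (shift_generated_comm gc) // => y ty; exact: t_comm.
Qed.

Lemma shift_tmul y a c m : shift (tmul gl y) a c ** m = shift (tmul gl y) a (c ** m).
Proof. by rewrite /shift linearBl linearZl_LR /= -(tmulA ef). Qed.

Lemma shifts_tmul y s c m : shifts (tmul gl y) c s ** m = shifts (tmul gl y) (c ** m) s.
Proof. by elim: s => //= a s IH; rewrite shift_tmul IH. Qed.

(** The factors of [c] commute and each is diagonalizable, so their second copies can be cancelled
    one at a time. *)
Lemma shift_generated_sqr0 c m : shift_generated t c -> c ** (c ** m) = 0 -> c ** m = 0.
Proof.
move=> gc; elim: gc m => [x /t_diag dx|c' y a gc' IH ty] m.
  by have [s us hs] := diag_tmul ef dx; apply: sqr0_of_shifts us (hs m).
have yc' u : y ** (c' ** u) = c' ** (y ** u).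
  by rewrite !(tmulA ef) (shift_generated_cent gc').
have shc u : shift (tmul gl y) a (c' ** u) = c' ** shift (tmul gl y) a u.
  by rewrite /shift linearBr linearZr_LR /= yc'.
rewrite !shift_tmul -!shc => h.
have [s us hs] := diag_tmul ef (t_diag ty).
have := shift_sqr0 us (hs _) h; rewrite !shc.
exact: IH.
Qed.

Lemma shift_generated_scalar c d : shift_generated t c ->
  (forall y, t y -> exists a, y ** d = a *: d) -> exists k, c ** d = k *: d.
Proof.
move=> gc hd; elim: gc => [x /hd //|c' y a _ [k IH] /hd[b yd]].
exists (b * k - a * k).
by rewrite shift_tmul /shift IH linearZr_LR /= yd !scalerA scalerBl mulrC.
Qed.

(* A simultaneous eigenprojection of [t], obtained as an element
   [(y_1 - a_1) ... (y_k - a_k) x] of minimal rank among those not killed by [z]. *)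
Lemma weight_idempotent z x : cent t z -> t x -> z ** x != 0 ->
  exists q, [/\ q ** q = q, z ** q != 0,
    forall y, t y -> exists a, y ** q = a *: q &
    forall m, cent t m -> m ** q = q ** m].
Proof.
move=> hz tx zx; pose P c := shift_generated t c /\ z ** c != 0.
have [|c [gc zc] cmin] := @left_ideal_minimal _ _ _ _ gl _ _ ef P.
  by exists x; split=> //; exact: shift_generated_base.
have [n hc] := supp_exists ef c.
(* By minimality [c] is a left multiple of any such product that is still in [P]. Since [m] commutes
   with both, it acts on [c] by the same scalar. *)
have transfer y s m k : P (shifts (tmul gl y) c s) -> cent t m ->
    m ** shifts (tmul gl y) c s = k *: shifts (tmul gl y) c s -> m ** c = k *: c.
  move=> Ps hm; have [d' cE] : exists d', c = d' ** shifts (tmul gl y) c s.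
    (* The identity of a corner containing [c] replaces the missing unit and turns the shifts of [c]
       into a left multiplication. *)
    by have := cmin (shifts (tmul gl y) (@embed _ _ _ _ gl e f n 1%:M) s);
      rewrite shifts_tmul (emb1_mul ef hc); apply.
  rewrite !(shift_generated_comm _ hm) //; last by case: Ps.
  by move=> h; rewrite {1}cE -(tmulA ef) h linearZr_LR /= -cE.
have gs y s : t y -> shift_generated t (shifts (tmul gl y) c s).
  by move=> ty; elim: s => //= a s IH; apply: shift_generated_shift.
have zshift y a m : t y -> z ** shift (tmul gl y) a m = shift (tmul gl y) a (z ** m).
  by move=> ty; rewrite /shift linearBr linearZr_LR /= !(tmulA ef) hz.
have eig y : t y -> exists a, y ** c = a *: c.
  move=> ty; have [s us hs] := diag_tmul ef (t_diag ty).
  have hy : cent t y by move=> u tu; exact: t_comm.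
  (* Otherwise every partial product would stay in [P]: if [z] killed the next one, then by
     [transfer] the element [z ** y - a *: z] would kill [c]. But the full product is zero. *)
  have [a as_ za] : exists2 a, a \in s & z ** shift (tmul gl y) a c = 0.
    apply: contrapT => h; suff [_] : P (shifts (tmul gl y) c s).
      by rewrite hs linear0r eqxx.
    have {}h a : a \in s -> z ** shift (tmul gl y) a c != 0.
      by move=> as_; apply/eqP => za; apply: h; exists a.
    move: h => {us hs}; elim: s => // a s IH h; have Ps : P (shifts (tmul gl y) c s).
      by apply: IH => b bs; apply: h; rewrite inE bs orbT.
    split; first exact: gs.
    apply: contraNN (h a (mem_head _ _)) => /eqP /=.
    have E u : z ** shift (tmul gl y) a u = (z ** y - a *: z) ** u.
      by rewrite linearBl linearZl_LR /shift linearBr linearZr_LR /= (tmulA ef).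
    rewrite !E => h0.
    rewrite (transfer y s _ 0) ?scale0r //.
    apply: (subspaceB (cent_subspace t)); first exact: cent_tmul.
    exact: (subspaceZ _ (cent_subspace t)).
  (* On [z ** c] the element [y] acts by [a], so the shifts by the other roots multiply it by
     nonzero scalars and stay in [P]; on their product [y] acts by [a]. *)
  exists a; apply: (transfer y (rem a s) _ _ _ hy).
    have : a \notin rem a s by rewrite mem_rem_uniqF.
    elim: (rem a s) => [|b r IH] //=; rewrite inE negb_or => /andP[ab /IH[_ zr]].
    split; first exact: (gs y (b :: r)).
    rewrite -/(shifts _ _ _) in zr *.
    have Z r' : z ** shift (tmul gl y) a (shifts (tmul gl y) c r') = 0.
      rewrite -shifts_shift; elim: r' => [|b' r' IHr] //=.
      rewrite -/(shifts _ _ _) zshift // IHr.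
      by rewrite /shift linear0r scaler0 subr0.
    have := Z r; rewrite /shift !linearBr !linearZr_LR /= => /eqP; rewrite subr_eq0 => /eqP ->.
    by rewrite -scalerBl scaler_eq0 negb_or subr_eq0 ab.
  apply/eqP; rewrite -subr_eq0; apply/eqP.
  by have := hs c; rewrite (perm_shifts _ _ (perm_to_rem as_)).
have [k cc] := shift_generated_scalar gc eig.
have k0 : k != 0.
  (* If [k = 0], then [c ** c = 0], and [shift_generated_sqr0] gives [c = 0]. *)
  apply: contraNN zc => /eqP k0; rewrite [c]tmul_eq0 ?linear0r // => m.
  by apply: shift_generated_sqr0 => //; rewrite (tmulA ef) cc k0 scale0r linear0l.
exists (k^-1 *: c); split.
- by rewrite linearZr_LR linearZl_LR /= cc !scalerA -mulrA mulVf // mulr1.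
- by rewrite linearZr_LR /= scaler_eq0 negb_or invr_eq0 k0.
- by move=> y /eig[a yc]; exists a; rewrite linearZr_LR /= yc !scalerA mulrC.
- by move=> m hm; rewrite linearZr_LR linearZl_LR /= (shift_generated_comm gc hm).
Qed.

End ShiftGenerated.
End ToralSubalgebras.

(** * Consequences of maximality *)

Section MaximalToral.
Context {K : numClosedFieldType} {V Vs : lmodType K}.
Context {pair : {bilinear V -> Vs -> K | *%R & *%R}}.
Context {gl : tensor_algebra pair} {e : nat -> V} {f : nat -> Vs}.
Hypothesis nondeg : nondegenerate_pairing pair.
Hypothesis ef : dual_bases pair e f.

Local Notation "x ** y" := (tmul gl x y) (at level 40, left associativity).
Local Notation act := (actV gl).
Local Notation coact := (actVs gl).
Local Notation ten := (tens gl).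
Implicit Types (x y z d m q h : gl).

Variable t : set gl.
Hypothesis t_max : maximal_toral t.

Let t_toral : toral_subalgebra t. Proof. by case: t_max. Qed.
Let t_subspace : is_subspace t. Proof. by have [[]] := t_toral. Qed.
Let t_diag x : t x -> diag x. Proof. exact: (toral_diag nondeg ef). Qed.
Let t_comm x y : t x -> t y -> x ** y = y ** x.
Proof. by move=> tx ty; apply/bracket_eq0; apply: (toral_abelian nondeg ef t_toral). Qed.

(** Adjoining the line of [h] to [t] gives commuting diagonalizable elements of [sl], hence a toral
    subalgebra containing [t]. *)
Lemma maximal_toral_mem h : diag h -> sl h -> cent t h -> t h.
Proof.
move=> dh slh ch; pose s := [set x + a *: h | x in t & a in [set: K]].
have ts : t `<=` s by move=> x tx; exists x => //; exists 0; rewrite // scale0r addr0.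
suff /t_max.2/(_ ts) <- : toral_subalgebra s.
  exists 0; first exact: (subspace0 t_subspace).
  by exists 1; rewrite // scale1r add0r.
have sS : is_subspace s.
  split; first exact: (ts _ (subspace0 t_subspace)).
  move=> a _ _ [x tx [b _ <-]] [y ty [c _ <-]].
  exists (a *: x + y); first exact: t_subspace.2.
  exists (a * b + c) => //.
  by rewrite scalerDr scalerA scalerDl addrACA.
split.
- split=> // _ _ [x tx [b _ <-]] [y ty [c _ <-]].
  suff -> : bracket (x + b *: h) (y + c *: h) = 0 by exact: (ts _ (subspace0 t_subspace)).
  apply/bracket_eq0; rewrite !linearDl !linearDr !linearZl_LR !linearZr_LR /= t_comm //.
  by rewrite (ch _ tx) (ch _ ty) addrACA !scalerA [c * b]mulrC.
- move=> _ [x tx [b _ <-]].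
  apply: (subspaceD (sl_subspace)); last exact: (subspaceZ _ sl_subspace).
  by have [_ tsl _] := t_toral; exact: tsl.
move=> _ [x tx [b _ <-]]; apply: (diag_semisimple nondeg ef).
  apply: diagD; [exact: t_diag|exact: diag_scale|].
  by rewrite linearZr_LR linearZl_LR /= ch.
apply: (subspaceD (sl_subspace)); last exact: (subspaceZ _ sl_subspace).
by have [_ tsl _] := t_toral; exact: tsl.
Qed.

(** A difference of two orthogonal idempotents of rank one; such elements serve to test
    maximality. *)
Lemma diag_sl_difference u1 w1 u2 w2 :
  pair u1 w1 = 1 -> pair u2 w2 = 1 -> pair u1 w2 = 0 -> pair u2 w1 = 0 ->
  let h := ten u1 w1 - ten u2 w2 in
  [/\ diag h, sl h, act h u1 = u1 & act h u2 = - u2].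
Proof.
move=> h11 h22 h12 h21 h; split.
- rewrite /h -scaleN1r; apply: diagD.
  + by apply: diag_idem; rewrite tmulE h11 scale1r.
  + by apply: diag_scale; apply: diag_idem; rewrite tmulE h22 scale1r.
  + by rewrite linearZr_LR linearZl_LR /= !tmulE h12 h21 !scale0r.
- by have := sl_tens_sub (gl := gl) u1 w1 h22; rewrite h11 scale1r.
- by rewrite linearBl /= !actVE h11 h12 scale1r scale0r subr0.
- by rewrite linearBl /= !actVE h22 h21 scale1r scale0r sub0r.
Qed.

Lemma maximal_toral_neq0 : exists2 x, t x & x != 0.
Proof.
have [pef _ _] := ef; apply: contrapT => ht.
have t0 x : t x -> x = 0.
  by move=> tx; apply: contrapT => /eqP x0; apply: ht; exists x.
have [dh slh he _] : let h := ten (e 0) (f 0) - ten (e 1) (f 1) in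
    [/\ diag h, sl h, act h (e 0) = e 0 & act h (e 1) = - e 1].
  by apply: diag_sl_difference; rewrite pef.
have th : t (ten (e 0) (f 0) - ten (e 1) (f 1)).
  by apply: maximal_toral_mem => // x /t0 ->; rewrite linear0l linear0r.
have := pef 0%N 0%N; rewrite -he (t0 _ th) !linear0l => /esym/eqP.
by rewrite oner_eq0.
Qed.

Lemma pair_neq0_ex v : v != 0 -> exists w, pair v w = 1.
Proof.
move=> v0; have [w vw] : exists w, pair v w != 0.
  apply: contrapT => hv; case/eqP: v0; apply: nondeg.1 => w.
  by apply: contrapT => vw; apply: hv; exists w; apply/eqP.
by exists ((pair v w)^-1 *: w); rewrite linearZr_LR /= mulVf.
Qed.

Lemma pair_neg_coact q u w : pair u (- coact q w) = pair (act q u) w.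
Proof. by rewrite linearNr pair_act. Qed.

Lemma tmul_tens_idem q u w : q ** q = q -> ten u (- coact q w) ** q = ten u (- coact q w).
Proof.
move=> qq; rewrite mul_tens_r [coact q _]linearNr /= -(coact_mul nondeg) qq.
by rewrite [RHS]linearNr.
Qed.

Lemma weight_rank_one q z : q ** q = q -> (forall y, t y -> exists a, y ** q = a *: q) ->
  (forall m, cent t m -> m ** q = q ** m) -> z ** q = q ** z ->
  exists k, z ** q = k *: q.
Proof.
move=> qq qw qc zq; have [q0|] := pselect (forall v, act q v = 0).
  exists 0; apply: (act_faithful ef) => v.
  by rewrite act_mul q0 linear0r scale0r linear0l.
move=> /existsNP[v /eqP u0]; set u := act q v in u0.
have qu : act q u = u by rewrite /u -act_mul qq.
have line v' : exists c, act q v' = c *: u.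
  have [w1 uw1] := pair_neq0_ex u0.
  pose u2 := act q v' - pair (act q v') w1 *: u.
  have [|u20] := eqVneq u2 0.
    by move/eqP; rewrite subr_eq0 => /eqP ->; eexists.
  have qu2 : act q u2 = u2 by rewrite linearBr linearZr_LR /= -act_mul qq qu.
  have u2w1 : pair u2 w1 = 0 by rewrite linearBl linearZl_LR /= uw1 mulr1 subrr.
  have [w2 u2w2] := pair_neq0_ex u20.
  (* The correction makes [w1], [w2'] dual to [u], [u2]. Composing these covectors with [q], as
     [- coact q w1] and [- coact q w2'], then gives [q ** h = h = h ** q]. *)
  pose w2' := w2 - pair u w2 *: w1.
  have uw2 : pair u w2' = 0 by rewrite linearBr linearZr_LR /= uw1 mulr1 subrr.
  have u2w2' : pair u2 w2' = 1 by rewrite linearBr linearZr_LR /= u2w1 mulr0 subr0.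
  have [] := @diag_sl_difference u (- coact q w1) u2 (- coact q w2');
    rewrite ?pair_neg_coact ?qu ?qu2 //.
  set h := _ - _ => dh slh hu hu2.
  have qh : q ** h = h by rewrite linearBr /= !mul_tens_l qu qu2.
  have hq : h ** q = h by rewrite linearBl /= !tmul_tens_idem.
  have th : t h.
    apply: maximal_toral_mem => // y ty; have [a yq] := qw y ty.
    have qy : q ** y = a *: q by rewrite -yq qc // => x tx; exact: t_comm.
    rewrite -{1}hq -(tmulA ef) qy -{2}qh (tmulA ef) yq.
    by rewrite linearZr_LR linearZl_LR /= hq qh.
  have [a haq] := qw h th; rewrite hq in haq.
  have au : u = a *: u by rewrite -{1}hu haq linearZl_LR /= qu.
  have au2 : - u2 = a *: u2 by rewrite -hu2 haq linearZl_LR /= qu2.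
  have a1 : a = 1.
    apply/eqP; rewrite -subr_eq0.
    have : (a - 1) *: u == 0 by rewrite scalerBl -au scale1r subrr.
    by rewrite scaler_eq0 (negPf u0) orbF.
  move: au2; rewrite a1 scale1r => /esym/eqP; rewrite -addr_eq0 -mulr2n -scaler_nat.
  by rewrite scaler_eq0 (negPf u20) orbF pnatr_eq0.
have [k zu] : exists k, act z u = k *: u.
  by have [k zk] := line (act z u); exists k; rewrite -zk -act_mul -zq act_mul qu.
exists k; apply: (act_faithful ef) => v'; have [c qv'] := line v'.
by rewrite act_mul linearZl_LR /= qv' linearZr_LR /= zu !scalerA mulrC.
Qed.

Lemma zero_weights_orthogonal v w :
  (forall y, t y -> act y v = 0) -> (forall y, t y -> coact y w = 0) -> pair v w = 0.
Proof.
move=> tv tw; apply: contrapT => /eqP vw0.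
have [x tx x0] := maximal_toral_neq0.
(* This supplies the hypothesis of [weight_idempotent] with [z] equal to [x], so the eigenprojection
   found has a nonzero weight. *)
have xx : x ** x != 0.
  apply: contraNN x0 => /eqP xx; apply/eqP; apply: (act_faithful ef) => u.
  rewrite linear0l; apply: (diag_sqr0 (t_diag tx)).
  by rewrite -act_mul xx linear0l.
have cx : cent t x by move=> y ty; exact: t_comm.
have [q [qq xq qw qc]] := weight_idempotent ef t_diag t_comm cx tx xx.
have [l xql] := qw x tx.
have l0 : l != 0 by apply: contraNN xq => /eqP l0; rewrite xql l0 scale0r.
have [u qu u0] : exists2 u, act q u = u & u != 0.
  apply: contrapT => hu; case/eqP: xq; apply: (act_faithful ef) => u.
  rewrite linear0l act_mul; suff -> : act q u = 0 by rewrite linear0r.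
  apply: contrapT => /eqP qu0; apply: hu; exists (act q u) => //.
  by rewrite -act_mul qq.
have xu : act x u = l *: u by rewrite -{1}qu -act_mul xql linearZl_LR /= qu.
have [w0 uw0] := pair_neq0_ex u0.
pose v1 := (pair v w)^-1 *: v.
have tv1 y : t y -> act y v1 = 0 by move=> ty; rewrite linearZr_LR /= tv // scaler0.
have v1w : pair v1 w = 1 by rewrite linearZl_LR /= mulVf.
(* As [x] acts on [q] by [l != 0] but kills [v1] and [w], the vectors [v1], [u] and their covectors
   form a dual system. *)
have qv1 : act q v1 = 0.
  have : l *: act q v1 = 0.
    by rewrite -linearZl_LR -xql qc // act_mul tv1 // linear0r.
  by move/eqP; rewrite scaler_eq0 (negPf l0) => /eqP.
have uw : pair u w = 0.
  have : l * pair u w = 0 by rewrite -linearZl_LR /= -xu pair_act tw // linear0r oppr0.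
  by move/eqP; rewrite mulf_eq0 (negPf l0) => /eqP.
have [] := @diag_sl_difference v1 w u (- coact q w0);
  rewrite ?pair_neg_coact ?qu ?qv1 ?linear0l //.
set h := _ - _ => dh slh hv1 _.
have th : t h.
  apply: maximal_toral_mem => // y ty; have [a yq] := qw y ty.
  have yu : act y u = a *: u by rewrite -{1}qu -act_mul yq linearZl_LR /= qu.
  have yw0 : coact y (- coact q w0) = - a *: (- coact q w0).
    rewrite linearNr /= -(coact_mul nondeg) -qc; last by move=> x' tx'; exact: t_comm.
    by rewrite yq linearZl_LR /= scalerN scaleNr opprK.
  rewrite /h linearBl linearBr /= !mul_tens_l !mul_tens_r tv1 // tw // yu yw0.
  by rewrite linear0l linear0r oppr0 linearZl_LR linearZr_LR /= scaleNr opprK.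
(* Contradiction: [h] fixes [v1], yet as an element of [t] it kills [v1]. *)
have := pair_neq0_ex; have := v1w; rewrite -hv1 tv1 // linear0l => /esym/eqP.
by rewrite oner_eq0.
Qed.

(** A minimal counterexample [z'] is replaced by [z' - q ** z'] for an eigenprojection [q] that it
    does not kill; the removed part is a multiple of [q], hence diagonalizable. *)
Lemma cent_decomposition z : cent t z ->
  exists y, [/\ cent t y, diag y & forall x, t x -> (z - y) ** x = 0].
Proof.
move=> hz; apply: contrapT => zbad.
pose P z := cent t z /\
  ~ exists y, [/\ cent t y, diag y & forall x, t x -> (z - y) ** x = 0].
have [|{hz zbad}z' [hz zbad] zmin] := @left_ideal_minimal _ _ _ _ gl _ _ ef P.
  by exists z.
apply: zbad; have [h|] := pselect (forall x, t x -> z' ** x = 0).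
  exists 0; split; first exact: (cent_subspace t).1.
    by apply: diag_idem; rewrite linear0l.
  by move=> x tx; rewrite subr0 h.
move=> /existsNP[x /not_implyP[tx /eqP zx]].
have [q [qq zq qw qc]] := weight_idempotent ef t_diag t_comm hz tx zx.
have cq : cent t q by move=> y ty; rewrite qc // => x' tx'; exact: t_comm.
have [k zqk] := weight_rank_one qq qw qc (qc _ hz).
have [n hn] := supp_exists ef z'.
have z1E : (@embed _ _ _ _ gl e f n 1%:M - q) ** z' = z' - q ** z'.
  by rewrite linearBl /= (emb1_mul ef hn).
have cz1 : cent t (z' - q ** z').
  by apply: (subspaceB (cent_subspace t)) => //; apply: (cent_tmul ef).
have [y [cy dy hy]] : exists y, [/\ cent t y, diag y &
    forall x, t x -> (z' - q ** z' - y) ** x = 0].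
  apply: contrapT => h; have [|d zE] := zmin (@embed _ _ _ _ gl e f n 1%:M - q).
    by rewrite z1E.
  (* Otherwise [z'] would be a left multiple of [z' - q ** z'], which [q] kills from the right,
     although [z' ** q] is nonzero. *)
  case/eqP: zq; rewrite zE z1E -(tmulA ef) linearBl /= -(qc _ hz) -(tmulA ef) qq subrr.
  by rewrite linear0r.
exists (y + k *: q); split.
- by apply: (subspaceD (cent_subspace t)) => //; exact: (subspaceZ _ (cent_subspace t)).
- apply: diagD => //; first by apply: diag_scale; exact: diag_idem.
  by rewrite linearZr_LR linearZl_LR /= qc.
move=> x' tx'; rewrite -zqk -[RHS](hy _ tx') qc //; congr (_ ** _).
by rewrite opprD addrCA addrC.
Qed.

End MaximalToral.

(** * The centralizer *)

Section Centralizer.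
Context {K : numClosedFieldType} {V Vs : lmodType K}.
Context {pair : {bilinear V -> Vs -> K | *%R & *%R}}.
Context {gl : tensor_algebra pair} {e : nat -> V} {f : nat -> Vs}.
Hypothesis nondeg : nondegenerate_pairing pair.
Hypothesis ef : dual_bases pair e f.
Variable t : set gl.
Hypothesis t_max : maximal_toral t.

Local Notation "x ** y" := (tmul gl x y) (at level 40, left associativity).
Local Notation act := (actV gl).
Local Notation coact := (actVs gl).
Local Notation ten := (tens gl).
Local Notation T0 := (tensor_set (gl := gl) (V0 t) (Vs0 t)).

Let t_toral : toral_subalgebra t. Proof. by case: t_max. Qed.
Let t_subspace : is_subspace t. Proof. by have [[]] := t_toral. Qed.
Let t_diag x : t x -> diag x. Proof. exact: (toral_diag nondeg ef). Qed.
Let t_comm x y : t x -> t y -> x ** y = y ** x.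
Proof. by move=> tx ty; apply/bracket_eq0; apply: (toral_abelian nondeg ef t_toral). Qed.

Lemma iter_eq0 (T : zmodType) (g : T -> T) v i :
  (forall u, g (g u) = 0 -> g u = 0) -> (0 < i)%N -> iter i g v = 0 -> g v = 0.
Proof. by move=> hg; elim: i => // -[//|i] IH _ /= /hg; apply: IH. Qed.

(** Elements of [t] are diagonalizable, so a vector killed by a power of one is killed by the
    element itself. *)
Lemma V0P v : V0 t v <-> forall x, t x -> act x v = 0.
Proof.
split=> [[i [i0 hi]] x tx|h]; last by exists 1%N; split.
by apply: iter_eq0 i0 (hi x tx) => u; apply: (diag_sqr0 (t_diag tx)).
Qed.

Lemma Vs0P w : Vs0 t w <-> forall x, t x -> coact x w = 0.
Proof.
split=> [[i [i0 hi]] x tx|h]; last by exists 1%N; split.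
by apply: iter_eq0 i0 (hi x tx) => u; apply: (diag_coact_sqr0 nondeg (t_diag tx)).
Qed.

Lemma T0_subspace : is_subspace T0.
Proof. exact: span_subspace. Qed.

Lemma T0_sl x : T0 x -> sl x.
Proof.
apply: (span_min sl_subspace) => _ [v [w [/V0P tv /Vs0P tw ->]]].
apply: (sl_tens ef); exact: (zero_weights_orthogonal nondeg ef t_max).
Qed.

Lemma tmul_T0 x z : t x -> T0 z -> x ** z = 0 /\ z ** x = 0.
Proof.
move=> tx; apply: (span_min (S := [set z | x ** z = 0 /\ z ** x = 0])).
  split=> [|a y1 y2 [h1 h2] [h3 h4]]; first by rewrite /= linear0l linear0r.
  by rewrite /= linearPl linearPr h1 h2 h3 h4 scaler0 addr0.
move=> _ [v [w [/V0P tv /Vs0P tw ->]]]; split; rewrite ?mul_tens_l ?mul_tens_r.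
  by rewrite tv // linear0l.
by rewrite tw // linear0r oppr0.
Qed.

Lemma T0_cent z : T0 z -> cent t z.
Proof. by move=> hz x tx; have [-> ->] := tmul_T0 tx hz. Qed.

Lemma T0_mul x y : T0 x -> T0 y -> x ** y = 0.
Proof.
move=> hx; apply: (span_min (S := [set y | x ** y = 0])).
  by split=> [|a y1 y2 /= h1 h2]; rewrite /= ?linear0r // linearPr h1 h2 scaler0 addr0.
move=> _ [v [w [/V0P tv /Vs0P tw ->]]]; move: x hx.
apply: (span_min (S := [set x | x ** ten v w = 0])).
  by split=> [|a y1 y2 /= h1 h2]; rewrite /= ?linear0l // linearPl h1 h2 scaler0 addr0.
move=> _ [v' [w' [/V0P tv' /Vs0P tw' ->]]] /=.
by rewrite tmulE (zero_weights_orthogonal nondeg ef t_max) // scale0r.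
Qed.

(** Write [z] as [z ** r ** z] and expand [r] into pure tensors; multiplying a pure tensor by [z] on
    both sides puts its factors into the zero weight spaces. *)
Lemma annihilator_T0 z : (forall x, t x -> z ** x = 0) -> (forall x, t x -> x ** z = 0) ->
  T0 z.
Proof.
move=> zt tz; have [r ->] := tmul_regular ef z.
move: r; apply: (tens_ind (P := [set r | T0 (z ** r ** z)])).
  apply: (subspace_preimage (applyr (tmul gl) z \o tmul gl z)).
  exact: T0_subspace.
move=> v w /=; rewrite mul_tens_l mul_tens_r -[- _]linearNr.
apply: subset_span; exists (act z v), (- coact z w); split=> //.
  by apply/V0P => x tx; rewrite -act_mul tz // linear0l.
apply/Vs0P => x tx; rewrite linearNr /= -(coact_mul nondeg) zt //.
by rewrite linear0l.
Qed.

Lemma centralizer_slE z : centralizer_sl t z <-> sl z /\ cent t z.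
Proof. by split=> -[slz h]; split=> // x tx; apply/bracket_eq0; exact: h. Qed.

Lemma centralizer_sl_sum : centralizer_sl t = [set x + y | x in t & y in T0].
Proof.
apply/seteqP; split=> [z /centralizer_slE[slz cz]|_ [x tx [y hy <-]]]; last first.
  apply/centralizer_slE; split; last first.
    apply: (subspaceD (cent_subspace t)) (T0_cent hy).
    by move=> x' tx'; exact: t_comm.
  apply: (subspaceD sl_subspace) (T0_sl hy).
  by have [_ tsl _] := t_toral; exact: tsl.
have [y [cy dy hy]] := cent_decomposition nondeg ef t_max cz.
have hT : T0 (z - y).
  apply: annihilator_T0 => // x tx.
  (* Since [z - y] commutes with [t], annihilation on one side gives the other. *)
  by rewrite -(hy x tx); apply/esym; apply: (subspaceB (cent_subspace t)) tx.
have sly : sl y by rewrite -(subKr z y); apply: (subspaceB sl_subspace) => //; exact: T0_sl.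
exists y; first exact: (maximal_toral_mem nondeg ef t_max).
by exists (z - y); rewrite // addrC subrK.
Qed.

(** A common element has square zero and is diagonalizable. *)
Lemma t_T0_disjoint : t `&` T0 = [set 0].
Proof.
apply/seteqP; split=> [x [tx hx]|_ ->]; last first.
  by split; [exact: (subspace0 t_subspace) | exact: (subspace0 T0_subspace)].
apply: (act_faithful ef) => v; rewrite linear0l; apply: (diag_sqr0 (t_diag tx)).
by rewrite -act_mul; have [-> _] := tmul_T0 tx hx; rewrite linear0l.
Qed.

Lemma centralizer_sl_abelian : is_abelian (centralizer_sl t).
Proof.
rewrite centralizer_sl_sum => _ _ [x1 tx1 [y1 hy1 <-]] [x2 tx2 [y2 hy2 <-]].
apply/bracket_eq0; rewrite !linearDl !linearDr /=.
have [-> ->] := tmul_T0 tx1 hy2; have [-> ->] := tmul_T0 tx2 hy1.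
by rewrite (t_comm tx1 tx2) (T0_mul hy1 hy2) (T0_mul hy2 hy1).
Qed.

Lemma centralizer_sl_subalgebra : is_subalgebra (centralizer_sl t).
Proof.
have hS : is_subspace (centralizer_sl t).
  have -> : centralizer_sl t = sl `&` cent t.
    by apply/seteqP; split=> z /centralizer_slE.
  exact: subspaceI sl_subspace (cent_subspace t).
by split=> // x y hx hy; rewrite centralizer_sl_abelian //; exact: subspace0.
Qed.

End Centralizer.

Theorem corollary4p9 (R : realType) (V Vs : lmodType R[i])
    (pair : {bilinear V -> Vs -> R[i] | *%R & *%R})
    (gl : tensor_algebra pair) (t : set gl) :
  countably_infinite_dim V ->
  countably_infinite_dim Vs ->
  nondegenerate_pairing pair ->
  maximal_toral t ->
  is_direct_sum t (tensor_set (V0 t) (Vs0 t)) (centralizer_sl t) /\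
  is_subalgebra (centralizer_sl t) /\ is_abelian (centralizer_sl t).
Proof.
move=> infV infVs nondeg t_max.
have [e [f ef]] := dual_bases_exist infV infVs nondeg.
split; last split.
- split; first exact: (centralizer_sl_sum nondeg ef t_max).
  exact: (t_T0_disjoint nondeg ef t_max).
- exact: (centralizer_sl_subalgebra nondeg ef t_max).
- exact: (centralizer_sl_abelian nondeg ef t_max).
Qed.
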